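(* Let $T>0$, let $(U,d_U)$ be a compact metric space, and let $f:\mathbb{R}^d\times U\to\mathbb{R}^d$ satisfy: (i) $f$ is continuous and there exists $m>0$ such that $|f(x,u)|\le m(1+|x|)$ for all $(x,u)\in\mathbb{R}^d\times U$; (ii) for each compact set $K\subset\mathbb{R}^d$ there exists $\ell_K>0$ such that $|f(x,u)-f(y,u)|\le \ell_K|x-y|$ for all $x,y\in K$ and $u\in U$. Let $\mathcal{K}_{(\tau,t)}$, $\mathcal{L}$ and $\mathcal{P}_{(\tau,t)}$, for $\tau,t\in[0,T]$, be the associated set-valued Koopman, Liouville and Perron-Frobenius operators. Then, one has that $$\mathcal{L}^*(\mu)=\overline{\mathrm{co}}\,\{-\mathrm{div}_x(f_u\mu)~:~u\in U\}\qquad\text{and}\qquad\mathcal{K}^*_{(\tau,t)}(\mu)=\overline{\mathrm{co}}\,\mathcal{P}_{(\tau,t)}(\mu)$$ for all $\mu\in\mathcal{X}^*$, where the (closed) convex hulls are taken with respect to the weak-$^*$ topology. In particular, if the set of controlled vector fields $\mathcal{F}:=\{f_u\in C^0(\mathbb{R}^d,\mathbb{R}^d)~:~u\in U\}$ is convex, then $$\mathcal{L}^*(\mu)=\{-\mathrm{div}_x(f_u\mu)~:~u\in U\}$$ for all $\mu\in\mathcal{X}^*$.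
   Context: For $u\in U$, $f_u:=f(\cdot,u)$. $\mathcal{X}:=C^0_c(\mathbb{R}^d,\mathbb{C})$ is the separable normed space of continuous complex-valued functions with compact support, endowed with the supremum norm, and $\mathcal{D}:=C^1_c(\mathbb{R}^d,\mathbb{C})$ is the separable normed space of continuously differentiable complex-valued functions with compact support, endowed with the corresponding $C^1$ supremum norm. For a locally convex topological vector space $\mathcal{E}$, $\mathcal{E}^*$ is its topological dual (the bounded complex-valued linear functionals on $\mathcal{E}$), with duality pairing $\langle\cdot,\cdot\rangle_{\mathcal{E}}$; dual spaces are endowed with the weak-$^*$ topology. One has $\mathcal{X}^*\simeq\mathcal{M}(\mathbb{R}^d,\mathbb{C})$, the space of finite complex-valued Radon measures. For $\mu\in\mathcal{M}(\mathbb{R}^d,\mathbb{C})$ and $g\in C^0(\mathbb{R}^d,\mathbb{R}^d)$, the divergence distribution $\mathrm{div}_x(g\mu)\in\mathcal{D}^*$ is defined by $\langle\mathrm{div}_x(g\mu),\zeta\rangle_{\mathcal{D}}:=-\int_{\mathbb{R}^d}\nabla_x\zeta(x)\cdot g(x)\,d\mu(x)$ for all $\zeta\in\mathcal{D}$. $\mathcal{U}$ is the set of Lebesgue-measurable maps $u:[0,T]\to U$. For $u(\cdot)\in\mathcal{U}$, the controlled flow $(\Phi^u_{(\tau,t)})_{\tau,t\in[0,T]}\subset C^0(\mathbb{R}^d,\mathbb{R}^d)$ is the unique solution of $\Phi^u_{(\tau,t)}(x)=x+\int_\tau^t f(\Phi^u_{(\tau,s)}(x),u(s))\,ds$ for all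 $\tau,t\in[0,T]$, $x\in\mathbb{R}^d$. The operators are: - Koopman: $\mathcal{K}_{(\tau,t)}(\varphi):=\{\varphi\circ\Phi^u_{(\tau,t)}~:~u(\cdot)\in\mathcal{U}\}\subset\mathcal{X}$ for $\varphi\in\mathcal{X}$; - Liouville: $\mathcal{L}(\varphi):=\{\nabla_x\varphi\cdot f_u~:~u\in U\}\subset\mathcal{X}$ for $\varphi\in\mathcal{D}$; - Perron-Frobenius: $\mathcal{P}_{(\tau,t)}(\mu):=\{\Phi^u_{(\tau,t)\sharp}\mu~:~u(\cdot)\in\mathcal{U}\}\subset\mathcal{X}^*$ for $\mu\in\mathcal{X}^*$, where $g_\sharp\mu(B):=\mu(g^{-1}(B))$ for Borel sets $B\subset\mathbb{R}^d$ is the pushforward measure. Adjoint: given two locally convex topological vector spaces $\mathcal{E},\mathcal{Y}$, the adjoint $F^*:\mathcal{Y}^*\rightrightarrows\mathcal{E}^*$ of a closed process $F:\mathcal{E}\rightrightarrows\mathcal{Y}$ (a set-valued map whose graph is a closed cone) is defined by $$F^*(\mu):=\Big\{\nu\in\mathcal{E}^*~:~\langle\nu,x\rangle_{\mathcal{E}}\le\sup_{y\in F(x)}\langle\mu,y\rangle_{\mathcal{Y}}~\text{ for all }x\in\mathcal{E}\Big\}$$ for all $\mu\in\mathcal{Y}^*$. The adjoints $\mathcal{L}^*:\mathcal{X}^*\rightrightarrows\mathcal{D}^*$ and $\mathcal{K}^*_{(\tau,t)}:\mathcal{X}^*\rightrightarrows\mathcal{X}^*$ are those given by this formula with $\mathcal{E}=\mathcal{D},\mathcal{Y}=\mathcal{X}$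 and with $\mathcal{E}=\mathcal{Y}=\mathcal{X}$, respectively.
   Formalization: Since −div_x(f_u μ) need not be bounded on D when f_u is not μ-integrable, the closed convex hull is taken among all functionals on D for pointwise convergence and intersected with D*; likewise the last right-hand side keeps only those −div_x(f_u μ) that lie in D*. *)

(* Defs.v *)
From HB Require Import structures.
From mathcomp Require Import all_boot all_order all_algebra.
From mathcomp Require Import all_classical all_reals all_analysis.
From mathcomp Require Import measurable_realfun.
From mathcomp Require Import complex ring.

Set Implicit Arguments.
Unset Strict Implicit.
Unset Printing Implicit Defensive.

Import Order.TTheory GRing.Theory Num.Theory.
Import numFieldNormedType.Exports.
Import numFieldTopology.Exports.

Local Open Scope classical_set_scope.
Local Open Scope ring_scope.

(* the complex numbers, as a normed space over themselves *)
Notation cplx R := ((complex R)^o).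

(* [`|z|] lives in [R[i]]; this is the same modulus as an element of [R] *)
Definition cmod {R : realType} (z : cplx R) : R := complex.Re (`|z| : complex R).

Section complex_facts.
Context {R : realType}.
Implicit Types z w : cplx R.

Lemma cmodE z : (cmod z)%:C%C = `|z| :> complex R.
Proof. by rewrite /cmod RRe_real// normr_real. Qed.

Lemma cmod_le z (r : R) : (cmod z <= r) = (`|z| <= r%:C%C :> complex R).
Proof. by rewrite -cmodE lecR. Qed.

Lemma cmod_ge0 z : 0 <= cmod z.
Proof. by rewrite -lecR cmodE normr_ge0. Qed.

Lemma cmodD z w : cmod (z + w) <= cmod z + cmod w.
Proof. by rewrite cmod_le rmorphD /= !cmodE ler_normD. Qed.

Lemma cmodM (z : complex R) w : cmod (z *: w) = cmod z * cmod w.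
Proof. by apply: complexI; rewrite rmorphM/= !cmodE normrM. Qed.

Lemma cmod0_eq0 z : cmod z = 0 -> z = 0.
Proof. by move=> z0; apply/eqP; rewrite -normr_eq0 -cmodE z0. Qed.

Lemma cmodN z : cmod (- z) = cmod z.
Proof. by rewrite /cmod normrN. Qed.

Lemma Re_le_cmod z : `|complex.Re z| <= cmod z.
Proof. by rewrite -lecR cmodE; exact: normc_ge_Re. Qed.

Lemma Im_le_cmod z : `|complex.Im z| <= cmod z.
Proof.
have -> : cmod z = cmod (z * 'i%C : complex R).
  by rewrite [RHS](@cmodM z 'i%C) /cmod [in X in _ * X]normc_def /= expr0n expr1n add0r sqrtr1 mulr1.
by rewrite -normrN -ReiNIm; exact: Re_le_cmod.
Qed.

Lemma cmod_le_ReIm z : cmod z <= `|complex.Re z| + `|complex.Im z|.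
Proof.
case: z => a b; rewrite /cmod normc_def/=.
rewrite -[leRHS]ger0_norm ?addr_ge0// -sqrtr_sqr; apply: ler_wsqrtr.
rewrite sqrrD !real_normK ?num_real// addrAC lerDl.
by rewrite mulrn_wge0// mulr_ge0.
Qed.

Lemma cplx_lipschitz_continuous (g : cplx R -> R) :
  (forall z w, `|g z - g w| <= cmod (z - w)) -> continuous g.
Proof.
move=> gl z; apply/(@cvgrPdist_lt _ _ _ _ (nbhs_filter z)) => e e0.
have e0' : 0 < e%:C%C :> complex R by rewrite ltcR.
have := @nbhsx_ballx _ (cplx R) z _ e0'; apply: filterS => w /=.
by rewrite /ball/= -cmodE ltcR; exact: le_lt_trans.
Qed.

Lemma continuous_cmod : continuous (@cmod R).
Proof.
apply: cplx_lipschitz_continuous => z w.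
have H (a b : cplx R) : cmod a - cmod b <= cmod (a - b).
  by rewrite lerBlDr (le_trans _ (cmodD _ _))// subrK.
by rewrite ler_norml H andbT lerNl opprB -(cmodN (z - w)) opprB H.
Qed.

Lemma continuous_Re : continuous (@complex.Re R : cplx R -> R).
Proof.
apply: cplx_lipschitz_continuous => z w.
by have := Re_le_cmod (z - w); rewrite raddfB.
Qed.

Lemma continuous_Im : continuous (@complex.Im R : cplx R -> R).
Proof.
apply: cplx_lipschitz_continuous => z w.
by have := Im_le_cmod (z - w); rewrite raddfB.
Qed.

End complex_facts.

Lemma continuous_lincomb (K : numFieldType) (T : topologicalType)
    (V : normedModType K) (a : K) (f g : T -> V) :
  continuous f -> continuous g -> continuous (fun x => a *: f x + g x).
Proof. by move=> fc gc x; apply: cvgD; [apply: cvgZl_tmp; exact: fc|exact: gc]. Qed.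

Lemma continuous_scaled (K : numFieldType) (T : topologicalType)
    (V : normedModType K) (a : K) (f : T -> V) :
  continuous f -> continuous (fun x => a *: f x).
Proof. by move=> fc x; apply: cvgZl_tmp; exact: fc. Qed.

Section Cc0_def.
Context (R : realType) (d : nat).

Definition csupport (phi : 'rV[R]_d -> cplx R) := closure [set x | phi x != 0].

Definition is_Cc0 (phi : 'rV[R]_d -> cplx R) :=
  continuous phi /\ compact (csupport phi).

Definition Cc0_pred : {pred ('rV[R]_d -> cplx R)} := mem [set phi | is_Cc0 phi].

Lemma Cc0_predP phi : reflect (is_Cc0 phi) (phi \in Cc0_pred).
Proof. by apply: (iffP idP); [move/set_mem|move/mem_set]. Qed.

Lemma compact_subclosure (A B : set 'rV[R]_d) :
  compact B -> closed B -> A `<=` B -> compact (closure A).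
Proof.
move=> cB clB AB; apply: (@subclosed_compact _ _ B) => //.
  exact: closed_closure.
by rewrite closureE; apply: bigcap_inf.
Qed.

Lemma Cc0_submod_closed : submod_closed Cc0_pred.
Proof.
split.
- apply/Cc0_predP; split; first exact: cst_continuous.
  rewrite /csupport (_ : [set x | _] = set0) ?closure0; first exact: compact0.
  by apply/seteqP; split => // x /=; rewrite eqxx.
- move=> a f g /Cc0_predP[fc fK] /Cc0_predP[gc gK]; apply/Cc0_predP; split.
    exact: (@continuous_lincomb _ _ (cplx R)).
  apply: (@compact_subclosure _ (csupport f `|` csupport g)).
  + exact: compactU.
  + by apply: closedU; exact: closed_closure.
  + move=> x /= fg0.
    case: (eqVneq (f x) 0) => [fx0|fx0]; last by left; exact: subset_closure.
    right; apply: subset_closure => /=; apply: contra fg0 => /eqP gx0.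
    apply/eqP; transitivity (a * f x + g x); first by [].
    by rewrite fx0 gx0 mulr0 addr0.
Qed.

HB.instance Definition _ :=
  GRing.isSubmodClosed.Build (complex R) ('rV[R]_d -> cplx R) Cc0_pred
    (GRing.submod_closed_semi Cc0_submod_closed).

Record Cc0 := MkCc0 {
  Cc0_fun :> 'rV[R]_d -> cplx R ;
  _ : Cc0_fun \in Cc0_pred }.

HB.instance Definition _ := [isSub for Cc0_fun].
HB.instance Definition _ := [Choice of Cc0 by <:].
HB.instance Definition _ := [SubChoice_isSubLmodule of Cc0 by <:].

Definition supnorm (phi : 'rV[R]_d -> cplx R) : R :=
  sup (range (fun x => cmod (phi x))).

End Cc0_def.

Section supnorm_facts.
Context (R : realType) (d : nat).
Implicit Types phi psi : 'rV[R]_d -> cplx R.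

Lemma Cc0_bounded phi : is_Cc0 phi ->
  exists M, forall x, cmod (phi x) <= M.
Proof.
move=> [phic phiK].
have [K0|/set0P K0] := eqVneq (csupport phi) set0.
  exists 0 => x; case: (eqVneq (phi x) 0) => [->|phix].
    by rewrite /cmod normr0.
  have : csupport phi x by exact: subset_closure.
  by rewrite K0.
have mc : continuous (fun x => cmod (phi x)).
  by move=> x; apply: (continuous_comp (phic x)); exact: continuous_cmod.
have [c _ cM] := compact_EVT_max K0 phiK (continuous_subspaceT mc).
exists (cmod (phi c)) => x; case: (eqVneq (phi x) 0) => [->|phix].
  by rewrite [leLHS]/cmod normr0 cmod_ge0.
by apply: cM; apply/mem_set; exact: subset_closure.
Qed.

Lemma Cc0_has_ubound phi : is_Cc0 phi ->
  has_ubound (range (fun x => cmod (phi x))).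
Proof. by move=> /Cc0_bounded[M hM]; exists M => _ [x _ <-]. Qed.

Lemma le_supnorm phi x : is_Cc0 phi -> cmod (phi x) <= supnorm phi.
Proof. by move=> /Cc0_has_ubound h; apply: ub_le_sup => //; exists x. Qed.

Lemma supnorm_le phi M : (forall x, cmod (phi x) <= M) -> supnorm phi <= M.
Proof.
move=> h; apply: ge_sup; first by exists (cmod (phi 0)), 0.
by move=> _ [x _ <-].
Qed.

Lemma supnormD phi psi : is_Cc0 phi -> is_Cc0 psi ->
  supnorm (fun x => phi x + psi x) <= supnorm phi + supnorm psi.
Proof.
move=> hphi hpsi; apply: supnorm_le => x.
by rewrite (le_trans (cmodD _ _))// lerD// le_supnorm.
Qed.

Lemma supnormZ_le (a : complex R) phi : is_Cc0 phi ->
  supnorm (fun x => a *: phi x) <= cmod a * supnorm phi.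
Proof.
move=> hphi; apply: supnorm_le => x.
by rewrite cmodM ler_wpM2l ?cmod_ge0 ?le_supnorm.
Qed.

Lemma is_Cc0Z (a : complex R) phi : is_Cc0 phi -> is_Cc0 (fun x => a *: phi x).
Proof.
move=> /Cc0_predP h; apply/Cc0_predP.
by have := rpredZ a h.
Qed.

Lemma supnormZ (a : complex R) phi : is_Cc0 phi ->
  supnorm (fun x => a *: phi x) = cmod a * supnorm phi.
Proof.
move=> hphi; apply/eqP; rewrite eq_le supnormZ_le//=.
have [->|a0] := eqVneq a 0.
  rewrite {1}/cmod normr0 mul0r; apply: (le_trans (cmod_ge0 (0 *: phi 0))).
  exact: (le_supnorm 0 (is_Cc0Z 0 hphi)).
have ca : 0 < cmod a by rewrite lt_def cmod_ge0 andbT; apply/eqP => /cmod0_eq0/eqP; exact/negP.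
rewrite -ler_pdivlMl//.
have /(supnormZ_le a^-1) := is_Cc0Z a hphi.
have -> : (fun x => a^-1 *: (a *: phi x)) = phi.
  by apply/funext => x; rewrite scalerA mulVf// scale1r.
suff -> : cmod a^-1 = (cmod a)^-1 by [].
by apply: complexI; rewrite fmorphV/= !cmodE normfV.
Qed.

Lemma supnorm0_eq0 phi : is_Cc0 phi -> supnorm phi = 0 -> forall x, phi x = 0.
Proof.
move=> hphi h x; apply: cmod0_eq0; apply/eqP.
by rewrite eq_le cmod_ge0 andbT -h le_supnorm.
Qed.

Lemma Cc0P (phi : Cc0 R d) : is_Cc0 phi.
Proof. by apply/Cc0_predP; case: phi. Qed.

End supnorm_facts.

Section Cc0_normed.
Context (R : realType) (d : nat).

Definition Cc0_norm (phi : Cc0 R d) : complex R := (supnorm phi)%:C%C.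

Let Cc0_normD (phi psi : Cc0 R d) :
  Cc0_norm (phi + psi) <= Cc0_norm phi + Cc0_norm psi.
Proof. by rewrite /Cc0_norm -rmorphD lecR; apply: supnormD; exact: Cc0P. Qed.

Let Cc0_normZ (a : complex R) (phi : Cc0 R d) :
  Cc0_norm (a *: phi) = `|a| * Cc0_norm phi.
Proof.
by rewrite /Cc0_norm -(cmodE a) -rmorphM; congr (_%:C%C); apply: supnormZ; exact: Cc0P.
Qed.

Let Cc0_norm_eq0 (phi : Cc0 R d) : Cc0_norm phi = 0 -> phi = 0.
Proof.
move=> /(@complexI R _ 0) h; apply/val_inj/funext => x.
exact: (supnorm0_eq0 (Cc0P phi) h).
Qed.

HB.instance Definition _ := Lmodule_isNormed.Build (complex R) (Cc0 R d)
  Cc0_normD Cc0_normZ Cc0_norm_eq0.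

End Cc0_normed.

Section Cc1_def.
Context (R : realType) (d : nat).
Implicit Types phi psi : 'rV[R]_d -> cplx R.

Definition repart phi : 'rV[R]_d -> R := fun x => complex.Re (phi x).
Definition impart phi : 'rV[R]_d -> R := fun x => complex.Im (phi x).

Definition cpartial (i : 'I_d) phi : 'rV[R]_d -> cplx R := fun x =>
  ('D_(delta_mx 0 i) (repart phi) x +i* 'D_(delta_mx 0 i) (impart phi) x)%C.

Definition is_Cc1 phi :=
  [/\ forall x, differentiable (repart phi) x,
      forall x, differentiable (impart phi) x,
      forall i, continuous (cpartial i phi) &
      compact (csupport phi)].

Definition Cc1_pred : {pred ('rV[R]_d -> cplx R)} := mem [set phi | is_Cc1 phi].

Lemma Cc1_predP phi : reflect (is_Cc1 phi) (phi \in Cc1_pred).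
Proof. by apply: (iffP idP); [move/set_mem|move/mem_set]. Qed.

Let lincomb (a : complex R) phi psi : 'rV[R]_d -> cplx R :=
  fun x => a *: phi x + psi x.

Let repart_lincomb a phi psi : repart (lincomb a phi psi) =
  (complex.Re a *: repart phi - complex.Im a *: impart phi) + repart psi.
Proof.
apply/funext => x; transitivity (complex.Re (a * phi x + psi x)); first by [].
transitivity ((complex.Re a * repart phi x - complex.Im a * impart phi x) + repart psi x); last by [].
by rewrite raddfD /=; congr (_ + _); rewrite /repart /impart; case: a => a b; case: (phi x).
Qed.

Let impart_lincomb a phi psi : impart (lincomb a phi psi) =
  (complex.Re a *: impart phi + complex.Im a *: repart phi) + impart psi.
Proof.
apply/funext => x; transitivity (complex.Im (a * phi x + psi x)); first by [].
transitivity ((complex.Re a * impart phi x + complex.Im a * repart phi x) + impart psi x); last by [].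
by rewrite raddfD /=; congr (_ + _); rewrite /repart /impart; case: a => a b; case: (phi x).
Qed.

Lemma cpartial_lincomb a i phi psi x :
  differentiable (repart phi) x -> differentiable (impart phi) x ->
  differentiable (repart psi) x -> differentiable (impart psi) x ->
  cpartial i (fun y => a *: phi y + psi y) x =
  a *: cpartial i phi x + cpartial i psi x.
Proof.
move=> rf mf rg mg; rewrite /cpartial -/(lincomb a phi psi).
rewrite repart_lincomb impart_lincomb.
have dd (g : 'rV[R]_d -> R) v : differentiable g x -> derivable g x v.
  exact: diff_derivable.
have dZ (g : 'rV[R]_d -> R) (k : R) : differentiable g x -> differentiable (k *: g) x.
  exact: differentiableZ.
rewrite deriveD; [|by apply: dd; apply: differentiableB; apply: dZ|exact: dd].
rewrite deriveB; [|by apply: dd; apply: dZ|by apply: dd; apply: dZ].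
rewrite [X in (_ +i* X)%C]deriveD; [|by apply: dd; apply: differentiableD; apply: dZ|exact: dd].
rewrite [X in (_ +i* (X + _))%C]deriveD; [|by apply: dd; apply: dZ|by apply: dd; apply: dZ].
rewrite !deriveZ; try exact: dd.
by apply/eqP; rewrite eq_complex/=; case: a => a b /=; rewrite !eqxx.
Qed.

Lemma csupport_cpartial i phi : csupport (cpartial i phi) `<=` csupport phi.
Proof.
rewrite {1}/csupport => x; rewrite closureE; apply; split; first exact: closed_closure.
move=> y /= ; apply: contraPP => yphi.
have near0 : \near y, phi y = 0.
  have : nbhs y (~` csupport phi).
    by apply: open_nbhs_nbhs; split => //; apply: closed_openC; exact: closed_closure.
  apply: filterS => z /= zphi; apply/eqP; apply: contraPT zphi => z0.
  by apply; exact: subset_closure.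
apply/negP; rewrite negbK /cpartial.
have -> : 'D_(delta_mx 0 i) (repart phi) y = 0.
  rewrite -[RHS](@derive_cst _ _ _ (0 : R^o) y (delta_mx 0 i)).
  by apply: near_eq_derive; apply: filterS near0 => z; rewrite /repart => ->.
have -> : 'D_(delta_mx 0 i) (impart phi) y = 0.
  rewrite -[RHS](@derive_cst _ _ _ (0 : R^o) y (delta_mx 0 i)).
  by apply: near_eq_derive; apply: filterS near0 => z; rewrite /impart => ->.
exact: eqxx.
Qed.

Lemma Cc1_submod_closed : submod_closed Cc1_pred.
Proof.
have cst0 : repart (0 : 'rV[R]_d -> cplx R) = cst 0 /\
            impart (0 : 'rV[R]_d -> cplx R) = cst 0 by [].
split.
- apply/Cc1_predP; case: cst0 => r0 m0; split.
  + by rewrite r0 => x; exact: differentiable_cst.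
  + by rewrite m0 => x; exact: differentiable_cst.
  + move=> i; rewrite /cpartial r0 m0.
    rewrite (_ : (fun x => _) = cst 0); first exact: cst_continuous.
    by apply/funext => x; rewrite !derive_cst.
  + rewrite /csupport (_ : [set x | _] = set0) ?closure0; first exact: compact0.
    by apply/seteqP; split => // x /=; rewrite eqxx.
- move=> a f g /Cc1_predP[fr fm fc fK] /Cc1_predP[gr gm gc gK].
  have -> : a *: f + g = lincomb a f g by [].
  apply/Cc1_predP; split.
  + move=> x; rewrite repart_lincomb.
    by apply: differentiableD => //; apply: differentiableB; exact: differentiableZ.
  + move=> x; rewrite impart_lincomb.
    by apply: differentiableD => //; apply: differentiableD; exact: differentiableZ.
  + move=> i; rewrite (_ : cpartial i _ = fun x => a *: cpartial i f x + cpartial i g x).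
      exact: (@continuous_lincomb _ _ (cplx R)).
    by apply/funext => x; apply: cpartial_lincomb.
  + apply: (@compact_subclosure _ _ _ (csupport f `|` csupport g)).
    * exact: compactU.
    * by apply: closedU; exact: closed_closure.
    * move=> x /= fg0.
      case: (eqVneq (f x) 0) => [fx0|fx0]; last by left; exact: subset_closure.
      right; apply: subset_closure => /=; apply: contra fg0 => /eqP gx0.
      apply/eqP; transitivity (a * f x + g x); first by [].
      by rewrite fx0 gx0 mulr0 addr0.
Qed.

HB.instance Definition _ :=
  GRing.isSubmodClosed.Build (complex R) ('rV[R]_d -> cplx R) Cc1_pred
    (GRing.submod_closed_semi Cc1_submod_closed).

Record Cc1 := MkCc1 {
  Cc1_fun :> 'rV[R]_d -> cplx R ;
  _ : Cc1_fun \in Cc1_pred }.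

HB.instance Definition _ := [isSub for Cc1_fun].
HB.instance Definition _ := [Choice of Cc1 by <:].
HB.instance Definition _ := [SubChoice_isSubLmodule of Cc1 by <:].

Lemma Cc1P (phi : Cc1) : is_Cc1 phi.
Proof. by apply/Cc1_predP; case: phi. Qed.

Lemma Cc1_Cc0 phi : is_Cc1 phi -> is_Cc0 phi.
Proof.
case=> pr pm pc pK; split=> // x.
have rc := differentiable_continuous (pr x).
have mc := differentiable_continuous (pm x).
apply/(@cvgrPdist_lt _ (cplx R) _ _ (nbhs_filter x)) => e e0.
have eR : e = (complex.Re e)%:C%C by rewrite RRe_real// gtr0_real.
have e20 : 0 < complex.Re e / 2 by rewrite divr_gt0// -ltcR -eR.
move/(@cvgrPdist_lt _ _ _ _ (nbhs_filter x))/(_ _ e20) : rc => rc.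
move/(@cvgrPdist_lt _ _ _ _ (nbhs_filter x))/(_ _ e20) : mc => mc.
apply: filterS2 rc mc => y; rewrite /repart /impart.
rewrite -!raddfB/= => ry my; rewrite eR -cmodE ltcR.
by rewrite (le_lt_trans (cmod_le_ReIm _))// [ltRHS]splitr ltrD.
Qed.

Lemma cpartial_Cc0 i phi : is_Cc1 phi -> is_Cc0 (cpartial i phi).
Proof.
case=> _ _ pc pK; split; first exact: pc.
apply: (subclosed_compact _ pK); first exact: closed_closure.
exact: csupport_cpartial.
Qed.

(* equivalent to [supnorm phi + sup |grad phi|] for any norm on gradients *)
Definition Cc1_norm (phi : Cc1) : complex R :=
  (supnorm phi + \sum_(i < d) supnorm (cpartial i phi))%:C%C.

Let Cc1_normD (phi psi : Cc1) :
  Cc1_norm (phi + psi) <= Cc1_norm phi + Cc1_norm psi.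
Proof.
have [[pr pm _ _] [qr qm _ _]] := (Cc1P phi, Cc1P psi).
rewrite /Cc1_norm -rmorphD lecR addrACA -big_split/= lerD//.
  by apply: supnormD; apply: Cc1_Cc0; exact: Cc1P.
apply: ler_sum => i _.
rewrite (_ : cpartial i _ = fun x => cpartial i phi x + cpartial i psi x).
  by apply: supnormD; apply: cpartial_Cc0; exact: Cc1P.
apply/funext => x; rewrite -[cpartial i phi x]scale1r -cpartial_lincomb//.
congr (cpartial _ _ x); apply/funext => y; rewrite scale1r //.
Qed.

Let cpartialZ (a : complex R) i (phi : Cc1) :
  cpartial i (a *: phi) = fun x => a *: cpartial i phi x.
Proof.
have [pr pm _ _] := Cc1P phi; have [zr zm _ _] := Cc1P 0.
apply/funext => x; transitivity (cpartial i (fun y => a *: phi y + (0 : Cc1) y) x).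
  by congr (cpartial _ _ x); apply/funext => y; rewrite addr0.
rewrite cpartial_lincomb//.
have -> : cpartial i (0 : Cc1) x = 0; last by rewrite addr0.
by apply/eqP; rewrite eq_complex/= !derive_cst eqxx.
Qed.

Let Cc1_normZ (a : complex R) (phi : Cc1) :
  Cc1_norm (a *: phi) = `|a| * Cc1_norm phi.
Proof.
rewrite /Cc1_norm -(cmodE a) -rmorphM; congr (_%:C%C).
rewrite mulrDr mulr_sumr; congr (_ + _).
  by apply: supnormZ; apply: Cc1_Cc0; exact: Cc1P.
apply: eq_bigr => i _; rewrite cpartialZ supnormZ//.
by apply: cpartial_Cc0; exact: Cc1P.
Qed.

Lemma supnorm_ge0 phi : is_Cc0 phi -> 0 <= supnorm phi.
Proof. by move=> h; rewrite (le_trans (cmod_ge0 (phi 0)))// le_supnorm. Qed.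

Let Cc1_norm_eq0 (phi : Cc1) : Cc1_norm phi = 0 -> phi = 0.
Proof.
move=> /(@complexI R _ 0)/eqP.
have phi0 := Cc1_Cc0 (Cc1P phi).
rewrite paddr_eq0; last 2 first.
- exact: supnorm_ge0.
- by apply: sumr_ge0 => i _; apply: supnorm_ge0; apply: cpartial_Cc0; exact: Cc1P.
move=> /andP[/eqP h _]; apply/val_inj/funext => x.
exact: (supnorm0_eq0 phi0 h).
Qed.

HB.instance Definition _ := Lmodule_isNormed.Build (complex R) Cc1
  Cc1_normD Cc1_normZ Cc1_norm_eq0.

End Cc1_def.

Section dual.
Context (R : realType).

Record tdual (E : tvsType (complex R)) := MkTdual {
  tdual_fun :> E -> cplx R ;
  tdual_linear : linear tdual_fun ;
  tdual_continuous : continuous tdual_fun }.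

Section weak_star.
Variable E : tvsType (complex R).

HB.instance Definition _ := gen_eqMixin (tdual E).
HB.instance Definition _ := gen_choiceMixin (tdual E).

(* weak-* topology: pointwise convergence of functionals *)
Notation weak_star :=
  (initial_topology (fun nu : tdual E => (nu : {ptws E -> cplx R}))).

(* [convex_set] over [R[i]] uses weights [t] with [0 <= t <= 1] in the order of
   [R[i]], hence real weights *)
Definition convex_hull (A : set (E -> cplx R)) : set (E -> cplx R) :=
  \bigcap_(C in [set C | convex_set C /\ A `<=` C]) C.

(* Weak-* closed convex hull, in [tdual E], of a set [A] of functionals on [E].
   When [A] consists of continuous functionals this is the usual weak-* closure
   of the convex hull, see [wstar_clcoE]. It is defined for arbitrary [A] because
   [divergence mu g] need not be bounded for the C^1 norm if [mu] does not
   integrate [g] (take [g x = x] and [mu] without first moment): the hull is then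
   formed among all functionals and its closure is traced on [tdual E]. *)
Definition wstar_clco (A : set (E -> cplx R)) : set (tdual E) :=
  [set nu | closure (convex_hull A : set {ptws E -> cplx R}) nu].

Lemma convex_hull_linear_continuous (A : set (E -> cplx R)) :
  (forall l, A l -> linear l /\ continuous l) ->
  forall l, convex_hull A l -> linear l /\ continuous l.
Proof.
move=> Al l /(_ [set l : E -> cplx R | linear l /\ continuous l]); apply; split; last exact: Al.
move=> k h t /set_mem[kl kc] /set_mem[hl hc]; apply/mem_set.
have -> : conv t k h = fun x => t%:num *: k x + (1 - t%:num) *: h x by [].
split.
  move=> a x y; rewrite kl hl !scalerDr addrACA; congr (_ + _).
  by rewrite !scalerA ![_ * a]mulrC.
have hc' := @continuous_scaled _ _ (cplx R) (1 - t%:num) h hc.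
exact: (@continuous_lincomb _ _ (cplx R) t%:num k _ kc hc').
Qed.

Lemma wstar_clcoE (A : set (tdual E)) :
  wstar_clco (@tdual_fun E @` A) =
  closure ([set nu : tdual E | convex_hull (@tdual_fun E @` A) nu]
    : set weak_star).
Proof.
have hA l : convex_hull (@tdual_fun E @` A) l -> exists nu : tdual E, l = nu.
  move=> /(@convex_hull_linear_continuous (@tdual_fun E @` A))[].
    by move=> _ [nu _ <-]; split; [exact: tdual_linear|exact: tdual_continuous].
  by move=> ll lc; exists (MkTdual ll lc).
apply/seteqP; split => nu nuA B.
- rewrite nbhsE => -[_ [[C oC <-] Cnu] CB].
  have [l [/[dup] /hA[k ->] kA Ck]] := nuA C (open_nbhs_nbhs (conj oC Cnu)).
  by exists k; split => //; exact: CB.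
- move=> /(@initial_continuous _ _ (fun nu : tdual E => (nu : {ptws E -> cplx R}))) nuB.
  by have [k [kA Bk]] := nuA _ nuB; exists (tdual_fun k).
Qed.

End weak_star.

(* the dual pairings are complex: they are compared through their real parts *)
Definition adjoint (E Y : tvsType (complex R)) (F : E -> set Y)
    (mu : tdual Y) : set (tdual E) :=
  [set nu | forall x : E, ((complex.Re (nu x))%:E <=
     ereal_sup [set (complex.Re (mu y))%:E | y in F x])%E].

End dual.
Arguments tdual_fun {R E}.

Section charge_integral.
Local Open Scope ring_scope.
Context d (T : measurableType d) (R : realType).
Implicit Types (nu : {charge set T -> \bar R}) (g : T -> R).

Let hahnP nu := svalP (cid (svalP (cid (Hahn_decomposition nu)))).

Definition charge_integral nu g : R :=
  Rintegral (jordan_pos (hahnP nu)) setT g -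
  Rintegral (jordan_neg (hahnP nu)) setT g.

Let bddP (mu : {finite_measure set T -> \bar R}) g (M : R) :
  measurable_fun setT g -> (forall x, `|g x| <= M) ->
  mu.-integrable setT (EFin \o g).
Proof.
move=> mg gM; apply: measurable_bounded_integrable => //.
  by rewrite ltey_eq fin_num_measure.
by exists M; split=> [|y My x _]; [exact: num_real|exact: le_trans (gM x) (ltW My)].
Qed.

Lemma charge_integralD nu g1 g2 (M1 M2 : R) :
  measurable_fun setT g1 -> measurable_fun setT g2 ->
  (forall x, `|g1 x| <= M1) -> (forall x, `|g2 x| <= M2) ->
  charge_integral nu (fun x => g1 x + g2 x) =
  charge_integral nu g1 + charge_integral nu g2.
Proof.
move=> m1 m2 b1 b2; rewrite /charge_integral !RintegralD//;
  try by (apply: bddP b1 || apply: bddP b2).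
by rewrite opprD addrACA.
Qed.

Lemma charge_integralZ nu (c : R) g (M : R) :
  measurable_fun setT g -> (forall x, `|g x| <= M) ->
  charge_integral nu (fun x => c * g x) = c * charge_integral nu g.
Proof.
move=> mg gM; rewrite /charge_integral !RintegralZl//; try exact: bddP gM.
by rewrite mulrBr.
Qed.

Lemma charge_integral_bound nu : exists2 K : R, 0 <= K &
  forall g (M : R), measurable_fun setT g -> (forall x, `|g x| <= M) ->
    `|charge_integral nu g| <= K * M.
Proof.
have bnd (mu : {finite_measure set T -> \bar R}) g (M : R) :
    measurable_fun setT g -> (forall x, `|g x| <= M) ->
    `|Rintegral mu setT g| <= fine (mu setT) * M.
  move=> mg gM; have ig := bddP mu mg gM.
  apply: (le_trans (le_normr_Rintegral _ ig)) => //.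
  have -> : fine (mu setT) * M = Rintegral mu setT (cst M).
    by rewrite Rintegral_cst// mulrC.
  apply: le_Rintegral => //.
  - exact: (integrable_norm ig).
  - exact: finite_measure_integrable_cst.
exists (fine (jordan_pos (hahnP nu) setT) + fine (jordan_neg (hahnP nu) setT)).
  by rewrite addr_ge0// fine_ge0.
move=> g M mg gM; rewrite /charge_integral mulrDl.
by rewrite (le_trans (ler_normB _ _))// lerD// bnd.
Qed.

End charge_integral.

Section complex_measure.
Context (R : realType) (d : nat).

Definition Rd : measurableType _ := g_sigma_algebraType (@open 'rV[R]_d).

(* A complex measure, given by its real and imaginary parts. A charge is finite,
   and every finite Borel measure on R^d is Radon. *)
Record cmeasure := CMeasure {
  cm_re : {charge set Rd -> \bar R} ;
  cm_im : {charge set Rd -> \bar R} }.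

Definition cintegral (mu : cmeasure) (phi : 'rV[R]_d -> cplx R) : cplx R :=
  ((charge_integral (cm_re mu) (repart phi) -
    charge_integral (cm_im mu) (impart phi)) +i*
   (charge_integral (cm_re mu) (impart phi) +
    charge_integral (cm_im mu) (repart phi)))%C.

Lemma continuous_measurable_Rd (g : 'rV[R]_d -> R) :
  continuous g -> measurable_fun setT (g : Rd -> R).
Proof.
move=> /continuousP cg; apply: (measurability _ (RGenOpens.measurableE R)).
move=> _ [_ [a [b ->] <-]]; rewrite setTI; apply: sub_sigma_algebra.
by apply: cg; exact: interval_open.
Qed.

Lemma continuous_repart (phi : 'rV[R]_d -> cplx R) :
  continuous phi -> continuous (repart phi).
Proof. by move=> pc x; apply: (continuous_comp (pc x)); exact: continuous_Re. Qed.

Lemma continuous_impart (phi : 'rV[R]_d -> cplx R) :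
  continuous phi -> continuous (impart phi).
Proof. by move=> pc x; apply: (continuous_comp (pc x)); exact: continuous_Im. Qed.

Let mRe (phi : Cc0 R d) : measurable_fun setT (repart phi : Rd -> R).
Proof. exact: (continuous_measurable_Rd (continuous_repart (proj1 (Cc0P phi)))). Qed.

Let mIm (phi : Cc0 R d) : measurable_fun setT (impart phi : Rd -> R).
Proof. exact: (continuous_measurable_Rd (continuous_impart (proj1 (Cc0P phi)))). Qed.

Let bRe (phi : Cc0 R d) x : `|repart phi x| <= supnorm phi.
Proof. by apply: (le_trans (Re_le_cmod _)); apply: le_supnorm; exact: Cc0P. Qed.

Let bIm (phi : Cc0 R d) x : `|impart phi x| <= supnorm phi.
Proof. by apply: (le_trans (Im_le_cmod _)); apply: le_supnorm; exact: Cc0P. Qed.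

Let combine (nu : {charge set Rd -> \bar R}) (p q : R) (g1 g2 g3 : 'rV[R]_d -> R) (M1 M2 M3 : R) :
  measurable_fun setT (g1 : Rd -> R) -> measurable_fun setT (g2 : Rd -> R) ->
  measurable_fun setT (g3 : Rd -> R) ->
  (forall x, `|g1 x| <= M1) -> (forall x, `|g2 x| <= M2) ->
  (forall x, `|g3 x| <= M3) ->
  charge_integral nu (fun x : Rd => p * g1 x + q * g2 x + g3 x) =
  p * charge_integral nu g1 + q * charge_integral nu g2 + charge_integral nu g3.
Proof.
move=> m1 m2 m3 b1 b2 b3.
have bZ (c M : R) (g : 'rV[R]_d -> R) : (forall x, `|g x| <= M) ->
    forall x, `|c * g x| <= `|c| * M.
  by move=> b x; rewrite normrM ler_wpM2l.
have mZ (c : R) (g : Rd -> R) : measurable_fun setT g ->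
    measurable_fun setT (fun x => c * g x) by move=> mg; exact: measurable_funM.
rewrite (@charge_integralD _ _ _ _ (fun x : Rd => p * g1 x + q * g2 x) g3 (`|p| * M1 + `|q| * M2) M3)//; last 2 first.
- by apply: measurable_funD; exact: mZ.
- by move=> x; rewrite (le_trans (ler_normD _ _))// lerD// bZ.
rewrite (@charge_integralD _ _ _ _ (fun x : Rd => p * g1 x) (fun x => q * g2 x) (`|p| * M1) (`|q| * M2))//;
  do ?[exact: mZ|exact: bZ].
by rewrite (charge_integralZ _ _ m1 b1) (charge_integralZ _ _ m2 b2).
Qed.

Lemma cintegral_linear (mu : cmeasure) :
  linear (fun phi : Cc0 R d => cintegral mu phi).
Proof.
move=> a phi psi; rewrite /cintegral.
have -> : repart (a *: phi + psi) = fun x : Rd =>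
    complex.Re a * repart phi x + (- complex.Im a) * impart phi x + repart psi x.
  apply/funext => x; rewrite mulNr.
  transitivity (complex.Re (a * phi x + psi x)); first by [].
  by rewrite raddfD/=; congr (_ + _); rewrite /repart /impart; case: a => a b; case: (phi x).
have -> : impart (a *: phi + psi) = fun x : Rd =>
    complex.Re a * impart phi x + complex.Im a * repart phi x + impart psi x.
  apply/funext => x.
  transitivity (complex.Im (a * phi x + psi x)); first by [].
  by rewrite raddfD/=; congr (_ + _); rewrite /repart /impart; case: a => a b; case: (phi x).
rewrite !(combine _ _ _ (mRe _) (mIm _) (mRe _) (bRe _) (bIm _) (bRe _)).
rewrite !(combine _ _ _ (mIm _) (mRe _) (mIm _) (bIm _) (bRe _) (bIm _)).
apply/eqP; rewrite eq_complex/=; case: a => a b /=.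
by apply/andP; split; apply/eqP; ring.
Qed.

Lemma cintegral_continuous (mu : cmeasure) :
  continuous (fun phi : Cc0 R d => cintegral mu phi).
Proof.
have [K1 K10 h1] := charge_integral_bound (cm_re mu).
have [K2 K20 h2] := charge_integral_bound (cm_im mu).
pose C := K1 + K2 + (K1 + K2).
have bnd (phi : Cc0 R d) : `|cintegral mu phi| <= C%:C%C * `|phi|.
  have -> : `|phi| = (supnorm phi)%:C%C by [].
  rewrite -cmodE -rmorphM lecR /C mulrDl (le_trans (cmod_le_ReIm _))//=.
  rewrite mulrDl lerD//.
    by rewrite (le_trans (ler_normB _ _))// lerD// ?h1 ?h2.
  by rewrite (le_trans (ler_normD _ _))// lerD// ?h1 ?h2.
pose f : {linear Cc0 R d -> cplx R} := HB.pack (fun phi : Cc0 R d => cintegral mu phi)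
  (GRing.isLinear.Build _ _ _ _ _ (@cintegral_linear mu)).
apply: (@bounded_linear_continuous _ (Cc0 R d) (cplx R) f).
apply/bounded_funP => r; exists (C%:C%C * r) => x xr.
apply: (le_trans (bnd x)); rewrite ler_wpM2l// lecR.
by rewrite /C !addr_ge0.
Qed.

(* the Riesz identification of complex Radon measures with the dual of [Cc0] *)
Definition measure_dual (mu : cmeasure) : tdual (Cc0 R d) :=
  MkTdual (cintegral_linear mu) (@cintegral_continuous mu).

Section pushforward.
Variables (g : 'rV[R]_d -> 'rV[R]_d) (mg : measurable_fun setT (g : Rd -> Rd)).

Definition charge_pushforward (nu : {charge set Rd -> \bar R}) :
    {charge set Rd -> \bar R} :=
  measure_function_pushforward__canonical__charge_Charge nu mg.

Lemma charge_pushforwardE (nu : {charge set Rd -> \bar R}) (B : set Rd) :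
  charge_pushforward nu B = nu (g @^-1` B).
Proof. by []. Qed.

Definition cpushforward (mu : cmeasure) : cmeasure :=
  CMeasure (charge_pushforward (cm_re mu)) (charge_pushforward (cm_im mu)).

End pushforward.

End complex_measure.

Lemma continuous_sum_mul (K : numFieldType) (T : topologicalType) (I : Type)
    (s : seq I) (a b : I -> T -> K^o) :
  (forall i, continuous (a i)) -> (forall i, continuous (b i)) ->
  continuous (fun x => \sum_(i <- s) (a i x * b i x) : K^o).
Proof.
move=> ac bc; elim: s => [|i s IH].
  under eq_fun do rewrite big_nil; exact: cst_continuous.
under eq_fun do rewrite big_cons.
move=> x; apply: cvgD; last exact: IH.
by apply: cvgM; [exact: ac|exact: bc].
Qed.

Section control_system.
Context (R : realType) (d : nat).

Definition enorm (x : 'rV[R]_d) : R := Num.sqrt (\sum_(i < d) x 0 i ^+ 2).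

Definition graddot (phi : 'rV[R]_d -> cplx R) (g : 'rV[R]_d -> 'rV[R]_d) :
    'rV[R]_d -> cplx R :=
  fun x => \sum_(i < d) cpartial i phi x * (g x 0 i)%:C%C.

Lemma graddot_Cc0 (phi : Cc1 R d) (g : 'rV[R]_d -> 'rV[R]_d) :
  continuous g -> is_Cc0 (graddot phi g).
Proof.
move=> gc; have [pr pm pc pK] := Cc1P phi; split; last first.
  apply: (@compact_subclosure _ _ _ (csupport phi)) => //.
    exact: closed_closure.
  move=> x /= h; apply: contrapT => xphi; move/eqP: h; apply.
  rewrite /graddot big1// => i _.
  have -> : cpartial i phi x = 0; last by rewrite mul0r.
  apply/eqP; apply: contrapT => /negP h; apply: xphi.
  by apply: (@csupport_cpartial _ _ i phi x); exact: subset_closure.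
have Cc (h : 'rV[R]_d -> R) : continuous h ->
    continuous (fun x => (h x)%:C%C : cplx R).
  move=> hc x; apply/(@cvgrPdist_lt _ (cplx R) _ _ (nbhs_filter x)) => e e0.
  have eR : e = (complex.Re e)%:C%C by rewrite RRe_real// gtr0_real.
  have e1 : 0 < complex.Re e by rewrite -ltcR -eR.
  move/(@cvgrPdist_lt _ _ _ _ (nbhs_filter x))/(_ _ e1) : (hc x).
  apply: filterS => y; rewrite eR -rmorphB -ltcR normc_def/= expr0n addr0.
  by rewrite sqrtr_sqr.
have gi i : continuous (fun x => g x 0 i).
  move=> x; apply: (@continuous_comp _ _ _ g (fun y : 'rV[R]_d => y 0 i) x (gc x)).
  exact: coord_continuous.
exact: (@continuous_sum_mul (complex R) _ _ _ (fun i => cpartial i phi)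
  (fun i x => (g x 0 i)%:C%C) pc (fun i => Cc _ (gi i))).
Qed.

Definition divergence (mu : cmeasure R d) (g : 'rV[R]_d -> 'rV[R]_d) :
    Cc1 R d -> cplx R :=
  fun zeta => - cintegral mu (graddot zeta g).

Context (U : metricType R) (f : 'rV[R]_d -> U -> 'rV[R]_d) (T : R).

(* the real line with the Lebesgue-measurable (not only Borel) sets *)
Definition LebR := caratheodory_type (R := R) ((wlength idfun)^*)%mu.

(* Only the values of a control on [[0, T]] are relevant. *)
Definition control (u : R -> U) :=
  forall B : set U, <<s open >> B ->
    measurable ([set t | 0 <= t <= T] `&` u @^-1` B : set LebR).

(* the oriented integral from [a] to [b] *)
Definition ointegral (a b : R) (h : R -> R) : R :=
  if a <= b then Rintegral (@completed_lebesgue_measure R) `[a, b] h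
  else - Rintegral (@completed_lebesgue_measure R) `[b, a] h.

(* The integrability clause makes the integral equation meaningful, since
   [Rintegral] also has a value on non-integrable functions. *)
Definition is_flow (u : R -> U) (Phi : R -> R -> 'rV[R]_d -> 'rV[R]_d) :=
  forall tau t, 0 <= tau <= T -> 0 <= t <= T ->
  [/\ continuous (Phi tau t),
    forall x i, (@completed_lebesgue_measure R).-integrable `[0, T]
      (fun s => (f (Phi tau s x) (u s) 0 i)%:E) &
    forall x i, Phi tau t x 0 i =
      x 0 i + ointegral tau t (fun s => f (Phi tau s x) (u s) 0 i)].

Definition koopman (tau t : R) (phi : Cc0 R d) : set (Cc0 R d) :=
  [set psi : Cc0 R d | exists u Phi, [/\ control u, is_flow u Phi &
    forall x, psi x = phi (Phi tau t x)]].

Definition liouville (phi : Cc1 R d) : set (Cc0 R d) :=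
  [set psi : Cc0 R d | exists u : U, forall x, psi x = graddot phi (f ^~ u) x].

Definition perron_frobenius (tau t : R) (mu : cmeasure R d) :
    set (tdual (Cc0 R d)) :=
  [set nu | exists u Phi (mPhi : measurable_fun setT (Phi tau t : Rd R d -> Rd R d)),
    [/\ control u, is_flow u Phi & nu = measure_dual (cpushforward mPhi mu)]].

Definition neg_divergences (mu : cmeasure R d) : set (Cc1 R d -> cplx R) :=
  [set (- divergence mu (f ^~ u)) | u in [set: U]].

End control_system.

(* Main.v *)
From HB Require Import structures.
Require Import Defs.
From mathcomp Require Import all_boot all_order all_algebra.
From mathcomp Require Import all_classical all_reals all_analysis.
From mathcomp Require Import measurable_realfun.
From mathcomp Require Import complex.
From mathcomp Require Import ring lra.

Import Order.TTheory GRing.Theory Num.Theory.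
Import numFieldNormedType.Exports.

Local Open Scope classical_set_scope.
Local Open Scope ring_scope.

Set Implicit Arguments.
Unset Strict Implicit.
Unset Printing Implicit Defensive.

(** All three identities are instances of one principle: in the weak-* topology,
a closed convex set is the intersection of the half-spaces that contain it.

The adjoint of a set-valued map [F] at [mu] consists of the functionals whose
real part is dominated by the function [x |-> sup (Re <mu, y>)], [y] ranging over
[F x]. For the Liouville operator, [<mu, grad zeta . f_u>] is by definition the
value at [zeta] of [- div (f_u mu)]; for the Koopman operator,
[<mu, phi \o Phi>] is the value at [phi] of the pushforward of [mu] by [Phi]. In
both cases the dominating function is therefore the support function of the set
whose closed convex hull is claimed to be the adjoint
([adjoint_wstar_clco]), and it remains to recover a closed convex hull from its
support function ([wstar_clcoP]).

A weak-* neighbourhood controls only finitely many evaluations. What has to be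
shown is therefore that, for finitely many points, the values of [nu] are
approximated by those of the convex hull ([convex_pointwise_approx]); this is
separation in a finite-dimensional space, proved by almost minimising a sum of
squares. It applies to functionals that are linear and pointwise bounded but
perhaps not continuous, as the divergences may be.

The analytic content is in checking that the two sides have the same values. For
the Koopman operator, [phi \o Phi] must have compact support: a Gronwall estimate,
run from the final to the initial time, shows that the flow is proper
([flow_comparable]). The same pairs of a control and a flow then occur on both
sides. The change of variables for charges rests on
the fact that integration against a charge can be computed from any decomposition
of it into two finite measures ([charge_integral_difference]).

If the set of controlled fields is convex, so is the set of divergences; it is
moreover the image of the compact space [U] under a map that is continuous for
pointwise convergence ([neg_divergence_continuous]), so that passing to the
closed convex hull adds nothing. *)

(** * Complex numbers *)

Lemma Re_scale_real (R : realType) (t : R) (z : cplx R) :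
  complex.Re (t%:C%C *: z) = t * complex.Re z.
Proof. by case: z => a b; rewrite /= mul0r subr0. Qed.

Lemma cmod_real (R : realType) (t : R) : 0 <= t -> cmod (t%:C%C) = t.
Proof. by move=> t0; rewrite /cmod ger0_norm ?lecR. Qed.

Lemma cmod_mul (R : realType) (z w : complex R) :
  cmod (z * w) = cmod z * cmod w.
Proof. by apply: complexI; rewrite rmorphM/= !cmodE normrM. Qed.

Lemma cmod_sqr (R : realType) (z : cplx R) :
  cmod z ^+ 2 = complex.Re z ^+ 2 + complex.Im z ^+ 2.
Proof.
case: z => a b; rewrite /cmod normc_def/= sqr_sqrtr//.
by rewrite addr_ge0 ?sqr_ge0.
Qed.

Lemma cmod_sqrD_scale (R : realType) (t : R) (z w : cplx R) :
  cmod (z + t%:C%C *: w) ^+ 2 =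
  cmod z ^+ 2 + 2 * t * complex.Re ((z^* )%C * w) + t ^+ 2 * cmod w ^+ 2.
Proof. by rewrite !cmod_sqr; case: z w => [a b] [c e] /=; ring. Qed.

(** * Convex sets of complex functionals *)

Section real_convexity.
Context (R : realType) (E : Type).
Implicit Types C : set (E -> cplx R).

Lemma convex_set_real_weight C g h (t : R) : convex_set C -> C g -> C h ->
  0 <= t <= 1 -> C (fun x => t%:C%C *: g x + (1 - t)%:C%C *: h x).
Proof.
move=> cC Cg Ch /andP[t0 t1].
have p0 : 0 <= t%:C%C :> complex R by rewrite lecR.
have p1 : t%:C%C <= 1 :> complex R by rewrite lecR.
have /set_mem Cc := cC g h (Itv01 p0 p1) (mem_set Cg) (mem_set Ch).
by rewrite (_ : (1 - t)%:C%C = 1 - t%:C%C) ?rmorphB.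
Qed.

(** A complex number between 0 and 1 is real, so real weights are all that convexity
over the complex numbers has to be tested on. *)
Lemma convex_set_of_real_weight C :
  (forall g h (t : R), C g -> C h -> 0 <= t <= 1 ->
     C (fun x => t%:C%C *: g x + (1 - t)%:C%C *: h x)) -> convex_set C.
Proof.
move=> cC g h t /set_mem Cg /set_mem Ch; apply/mem_set.
have t0 : 0 <= t%:num by exact: ge0.
have t1 : t%:num <= 1 by exact: le1.
have tR : t%:num = (complex.Re t%:num)%:C%C :> complex R.
  by rewrite RRe_real// ger0_real.
have t01 : 0 <= complex.Re t%:num <= 1 by rewrite -!lecR -tR t0.
have := cC g h _ Cg Ch t01.
have -> : (1 - complex.Re t%:num)%:C%C = 1 - t%:num :> complex R.
  by rewrite [in RHS]tR rmorphB.
by rewrite -tR.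
Qed.

Lemma convex_halfspace (x : E) (r : R) :
  convex_set [set g : E -> cplx R | complex.Re (g x) <= r].
Proof.
apply: convex_set_of_real_weight => g h t /= gr hr /andP[t0 t1].
rewrite raddfD/= !Re_scale_real.
have : t * complex.Re (g x) <= t * r by rewrite ler_wpM2l.
have : (1 - t) * complex.Re (h x) <= (1 - t) * r by rewrite ler_wpM2l ?subr_ge0.
lra.
Qed.

Lemma convex_cmod_ball (x : E) (r : R) :
  convex_set [set g : E -> cplx R | cmod (g x) <= r].
Proof.
apply: convex_set_of_real_weight => g h t /= gr hr /andP[t0 t1].
apply: (le_trans (cmodD _ _)); rewrite !cmodM !cmod_real ?subr_ge0//.
have : t * cmod (g x) <= t * r by rewrite ler_wpM2l.
have : (1 - t) * cmod (h x) <= (1 - t) * r by rewrite ler_wpM2l ?subr_ge0.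
lra.
Qed.

End real_convexity.

Lemma convex_linear (R : realType) (E : lmodType (complex R)) :
  convex_set [set g : E -> cplx R | linear g].
Proof.
apply: convex_set_of_real_weight => g h t lg lh _ a x y; rewrite lg lh.
by rewrite !scalerDr !scalerA addrACA ![a * _]mulrC.
Qed.

Section convex_hulls.
Context (R : realType).

Lemma convex_hull_convex (E : tvsType (complex R)) (A : set (E -> cplx R)) :
  convex_set (convex_hull A).
Proof.
move=> g h t /set_mem Ag /set_mem Ah; apply/mem_set => C CA.
by apply/set_mem; apply: CA.1; apply/mem_set; [exact: Ag|exact: Ah].
Qed.

Lemma sub_convex_hull (E : tvsType (complex R)) (A : set (E -> cplx R)) :
  A `<=` convex_hull A.
Proof. by move=> g Ag C [_]; apply. Qed.

Lemma convex_hull_min (E : tvsType (complex R)) (A C : set (E -> cplx R)) :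
  convex_set C -> A `<=` C -> convex_hull A `<=` C.
Proof. by move=> cC AC g; apply. Qed.

End convex_hulls.

(** * Separation from convex sets of functionals *)

Section duality.
Context (R : realType).

(** Finite-dimensional separation by an almost nearest point: take a [g] in [C]
that almost minimises the sum [Q] of the squared distances to [nu] at the points
of [s]. Almost minimality, tested along the segment from [g] to [a], gives
[Re (a y) <= Re (g y)] up to a small error for every [a] in [C], where [y] is the
combination of the points of [s] that represents the direction from [g] to [nu].
The support inequality transfers this bound to [nu], and since
[Re (nu y) - Re (g y)] is [Q g], it forces [Q g] to be small. Boundedness of [C]
makes the quadratic error uniform in [a]. *)
Lemma convex_pointwise_approx (E : lmodType (complex R))
    (C : set (E -> cplx R)) (nu : E -> cplx R) :
  convex_set C -> (forall g, C g -> linear g) -> linear nu ->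
  (forall x, exists M, forall g, C g -> cmod (g x) <= M) ->
  (forall x r, (forall g, C g -> complex.Re (g x) <= r) ->
    complex.Re (nu x) <= r) ->
  forall (s : seq E) (e : R), 0 < e ->
  exists2 g, C g & forall x, x \in s -> cmod (g x - nu x) < e.
Proof.
move=> cC lC lnu bC nuC s e e0.
(* If [C] were empty, the support inequality would hold with [r] below
   [Re (nu 0)]. *)
have [c Cc] : exists c, C c.
  apply: contrapT => /forallNP nC.
  have : complex.Re (nu 0) <= complex.Re (nu 0) - 1.
    by apply: nuC => g /nC.
  by lra.
pose Q (g : E -> cplx R) := \sum_(x <- s) cmod (g x - nu x) ^+ 2.
have Q0 g : 0 <= Q g by apply: sumr_ge0 => x _; exact: sqr_ge0.
have [M bM] : exists M, forall g a, C g -> C a ->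
    \sum_(x <- s) cmod (a x - g x) ^+ 2 <= M.
  have /choice[N bN] := bC.
  exists (\sum_(x <- s) (N x + N x) ^+ 2) => g a Cg Ca.
  apply: ler_sum => x _; rewrite ler_sqr ?nnegrE ?cmod_ge0//.
    by rewrite (le_trans (cmodD _ _))// cmodN lerD// bN.
  by rewrite addr_ge0// (le_trans (cmod_ge0 (g x)))// bN.
have M0 : 0 <= M.
  by apply: le_trans (bM c c Cc Cc); apply: sumr_ge0 => x _; exact: sqr_ge0.
(* The step [t] along the segments; near-minimality is required up to [t ^+ 2], so
   that after division by [t] every error term is of order [t]. *)
pose t := Num.min 1 (e ^+ 2 / (1 + M)).
have t0 : 0 < t by rewrite lt_min ltr01 divr_gt0// ?exprn_gt0//; lra.
have t1 : t <= 1 by rewrite ge_min lexx.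
have tM : t * (1 + M) <= e ^+ 2.
  by rewrite -ler_pdivlMr ?ge_min ?lexx ?orbT//; lra.
have hD : has_inf (Q @` C) by split; [exists (Q c), c|exists 0 => _ [g _ <-]].
have [_ [g Cg <-] Qg] := inf_adherent (exprn_gt0 2 t0) hD.
exists g => //.
pose z x : complex R := - ((g x - nu x)^*)%C.
pose y := \sum_(x <- s) z x *: x.
have lE l : linear l -> l y = \sum_(x <- s) z x * l x.
  move=> ll; pose L : {linear E -> cplx R} := HB.pack l
    (GRing.isLinear.Build _ _ _ _ _ ll).
  rewrite -[l]/(L : E -> cplx R) /y linear_sum; apply: eq_bigr => x _.
  by rewrite linearZ.
have gyle a : C a -> complex.Re (a y) <= complex.Re (g y) + e ^+ 2 / 2.
  move=> Ca.
  have /ge_inf le1 :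
      (Q @` C) (Q (fun x => t%:C%C *: a x + (1 - t)%:C%C *: g x)).
    by apply: imageP; apply: convex_set_real_weight; rewrite ?(ltW t0).
  have {le1} := le1 hD.2.
  have -> : Q (fun x => t%:C%C *: a x + (1 - t)%:C%C *: g x) =
      Q g + 2 * t * (complex.Re (g y) - complex.Re (a y)) +
      t ^+ 2 * \sum_(x <- s) cmod (a x - g x) ^+ 2.
    rewrite !(lE _ (lC _ _))// -raddfB -sumrB raddf_sum/= !mulr_sumr -!big_split/=.
    apply: eq_bigr => x _; rewrite -mulrBr.
    have -> : t%:C%C *: a x + (1 - t)%:C%C *: g x - nu x =
        (g x - nu x) + t%:C%C *: (a x - g x).
      rewrite rmorphB/=; move: (a x) (g x) (nu x) => ? ? ?.
      by rewrite scalerBl scalerBr scale1r; ring.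
    by rewrite cmod_sqrD_scale /z mulNr -mulrN opprB.
  have := bM g a Cg Ca; move: (\sum_(x <- s) _) => W WM.
  move=> h.
  have h2 : 0 < 2 * t * (complex.Re (g y) - complex.Re (a y)) + t ^+ 2 * W + t ^+ 2.
    lra.
  have {h2} : 0 < t * (2 * (complex.Re (g y) - complex.Re (a y)) + t * W + t).
    by congr (_ < _): h2; ring.
  rewrite pmulr_rgt0// => h2.
  have : t * W <= t * M by rewrite ler_pM2l.
  lra.
have := nuC _ _ gyle.
have gnu : complex.Re (g y) - complex.Re (nu y) = - Q g.
  rewrite (lE _ lnu) (lE _ (lC _ Cg)) -raddfB -sumrB raddf_sum/= /Q -sumrN.
  apply: eq_bigr => x _; rewrite -mulrBr /z cmod_sqr.
  by case: (g x - nu x) => p q /=; ring.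
move=> le2.
have e20 : 0 < e ^+ 2 by rewrite exprn_gt0.
have Qe : Q g < e ^+ 2 by lra.
move=> x xs; rewrite -(@ltr_pXn2r _ 2)// ?nnegrE ?cmod_ge0 ?ltW//.
apply: le_lt_trans Qe.
rewrite /Q (big_rem x)//= lerDl; apply: sumr_ge0 => *; exact: sqr_ge0.
Qed.

(** The sets of functions of [C] that are close to [nu] at finitely many points
form a filter base; its filter contains [C] and converges pointwise to [nu]. *)
Lemma closure_ptws_approx (T : topologicalType) (C : set (T -> cplx R))
    (nu : T -> cplx R) :
  (forall (s : seq T) (e : R), 0 < e ->
    exists2 g, C g & forall x, x \in s -> cmod (g x - nu x) < e) ->
  closure (C : set {ptws T -> cplx R}) nu.
Proof.
move=> h.
pose B (p : seq T * R) :=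
  [set g | C g /\ forall x, x \in p.1 -> cmod (g x - nu x) < p.2].
pose F := filter_from [set p : seq T * R | 0 < p.2] B.
have FF : ProperFilter F.
  apply: filter_from_proper; last by move=> [s e] /= /(h s)[g Cg gs]; exists g.
  apply: filter_from_filter; first by exists ([::], 1) => /=.
  move=> [s e] [s' e'] /= e0 e0'; exists (s ++ s', Num.min e e') => /=.
    by rewrite lt_min e0.
  move=> g [Cg /= gs]; split; split => //= x xs.
  - have := gs x; rewrite mem_cat xs => /(_ isT).
    by rewrite lt_min => /andP[].
  - have := gs x; rewrite mem_cat xs orbT => /(_ isT).
    by rewrite lt_min => /andP[].
rewrite closureEcvg; exists F => //; split; last first.
  move=> A CA; exists ([::], 1) => //= g [Cg _]; exact: CA.
apply/pointwise_cvgP => x; apply/(@cvgrPdist_lt _ (cplx R)) => e e0.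
have eR : e = (complex.Re e)%:C%C by rewrite RRe_real// gtr0_real.
have e1 : 0 < complex.Re e by rewrite -ltcR -eR.
exists ([:: x], complex.Re e) => //= g [_ /(_ x)] /=.
by rewrite mem_head => /(_ isT); rewrite eR -cmodE ltcR -cmodN opprB.
Qed.

End duality.

(** * Adjoints and weak-* closed convex hulls *)

Section support_function.
Context (R : realType).

Lemma closed_ptws_halfspace (T : topologicalType) (x : T) (r : R) :
  closed [set g : {ptws T -> cplx R} | complex.Re (g x) <= r].
Proof.
have ec : continuous (fun g : {ptws T -> cplx R} => complex.Re (g x)).
  move=> g; apply: (@continuous_comp _ _ _
    (fun g : {ptws T -> cplx R} => g x) (@complex.Re R : cplx R -> R)).
    exact: (@proj_continuous T (fun=> cplx R) x).
  exact: continuous_Re.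
exact: (preimage_closed (fun g _ => ec g) (@closed_le _ r)).
Qed.

(** A closed convex set is the intersection of the half-spaces that contain it.
One direction holds because half-spaces are convex and closed for pointwise
convergence; the other is the separation lemma applied to the convex hull of
[A], on which evaluations are bounded as they are on [A]. *)
Lemma wstar_clcoP (E : tvsType (complex R)) (A : set (E -> cplx R))
    (nu : tdual E) :
  (forall a, A a -> linear a) ->
  (forall x, exists M, forall a, A a -> cmod (a x) <= M) ->
  wstar_clco A nu <->
  forall x, ((complex.Re (nu x))%:E <=
    ereal_sup [set (complex.Re (a x))%:E | a in A])%E.
Proof.
move=> lA bA; split.
- move=> nuA x; set S := ereal_sup _.
  have nur r : (S <= r%:E)%E -> complex.Re (nu x) <= r.
    move=> Sr; pose H := [set g : E -> cplx R | complex.Re (g x) <= r].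
    have AH : A `<=` H.
      move=> a Aa; rewrite /H/= -lee_fin (le_trans _ Sr)//.
      by apply: ereal_sup_ubound; exists a.
    have HH : convex_hull A `<=` H.
      exact: convex_hull_min (@convex_halfspace R E x r) AH.
    have := @closureS {ptws E -> cplx R} _ _ HH _ nuA.
    by rewrite -(closure_id _).1//; exact: closed_ptws_halfspace.
  case: S nur => [r| |] nur; rewrite ?leey ?lee_fin ?nur//.
  (* Supremum [-oo]: every real number is then an upper bound of [Re (nu x)]. *)
  have := nur (complex.Re (nu x) - 1).
  by rewrite leNye lerBrDr gerDl ler10 => /(_ isT).
- move=> nuS; apply: closure_ptws_approx; apply: convex_pointwise_approx.
  + exact: convex_hull_convex.
  + exact: (convex_hull_min (@convex_linear R E) lA).
  + exact: tdual_linear.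
  + move=> x; have [M AM] := bA x; exists M.
    exact: (convex_hull_min (@convex_cmod_ball R E x M) AM).
  + move=> x r hr; rewrite -lee_fin (le_trans (nuS x))//.
    apply: ge_ereal_sup => _ [a Aa <-]; rewrite lee_fin hr//.
    exact: sub_convex_hull.
Qed.

(** The common core of the adjoint formulas: the supremum in the definition of
the adjoint of [F] at [x] is the support function at [x] of a set [A] of
functionals as soon as [mu] takes on [F x] the values that the elements of [A]
take at [x]. *)
Lemma adjoint_wstar_clco (E Y : tvsType (complex R)) (F : E -> set Y)
    (mu : tdual Y) (A : set (E -> cplx R)) :
  (forall a, A a -> linear a) ->
  (forall x, exists M, forall a, A a -> cmod (a x) <= M) ->
  (forall x, [set mu y | y in F x] = [set a x | a in A]) ->
  adjoint F mu = wstar_clco A.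
Proof.
move=> lA bA FA; apply/seteqP; split => nu.
  move=> h; apply/wstar_clcoP => // x.
  have -> : [set (complex.Re (a x))%:E | a in A] =
      (fun z => (complex.Re z)%:E) @` [set a x | a in A] by rewrite image_comp.
  by rewrite -FA image_comp; exact: h.
move=> /wstar_clcoP h x; have := h lA bA x.
have -> : [set (complex.Re (a x))%:E | a in A] =
    (fun z => (complex.Re z)%:E) @` [set a x | a in A] by rewrite image_comp.
by rewrite -FA image_comp.
Qed.

End support_function.

(** * Integration against charges and complex measures *)

Section change_of_variables.
Context d (T : measurableType d) (R : realType).
Implicit Types (nu : {charge set T -> \bar R}) (g : T -> R).

(** Integration against a charge, defined by one particular Hahn decomposition,
can be computed from any expression of the charge as a difference of finite
measures: [p - n = m1 - m2] is the equality [p + m2 = m1 + n] of measures. *)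
Lemma charge_integral_difference nu (m1 m2 : {measure set T -> \bar R}) g (M : R) :
  fin_num_fun m1 -> fin_num_fun m2 ->
  (forall B, measurable B -> nu B = (m1 B - m2 B)%E) ->
  measurable_fun setT g -> (forall x, `|g x| <= M) ->
  charge_integral nu g = Rintegral m1 setT g - Rintegral m2 setT g.
Proof.
move=> fm1 fm2 nuE mg gM; rewrite /charge_integral.
set p := (X in jordan_pos X); clearbody p.
have fp : fin_num_fun (jordan_pos p) by move=> B; exact: fin_num_measure.
have fn : fin_num_fun (jordan_neg p) by move=> B; exact: fin_num_measure.
have ig (mu : {measure set T -> \bar R}) : fin_num_fun mu ->
    mu.-integrable setT (EFin \o g).
  move=> fmu; apply: measurable_bounded_integrable => //.
    by rewrite ltey_eq fmu.
  exists M; split=> [|y My x _]; first exact: num_real.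
  exact: le_trans (gM x) (ltW My).
have /measurable_EFinP mEg := mg.
have Rint_add (m m' : {measure set T -> \bar R}) :
    fin_num_fun m -> fin_num_fun m' ->
    Rintegral m setT g + Rintegral m' setT g =
    fine (\int[measure_add m m']_x (g x)%:E)%E.
  move=> fm fm'; rewrite integral_measure_add//; try exact: ig.
  by rewrite fineD//; apply: integrable_fin_num => //; exact: ig.
have : Rintegral (jordan_pos p) setT g + Rintegral m2 setT g =
    Rintegral m1 setT g + Rintegral (jordan_neg p) setT g.
  rewrite (Rint_add (jordan_pos p))// (Rint_add m1)//.
  congr fine; apply: eq_measure_integral => B mB _.
  transitivity (jordan_pos p B + m2 B)%E; first exact: measure_addE.
  transitivity (m1 B + jordan_neg p B)%E; last exact/esym/measure_addE.
  have := nuE _ mB; rewrite (jordan_decomp p mB) /cadd/= cscaleN1.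
  have := (fp _ mB, fn _ mB, fm1 _ mB, fm2 _ mB).
  rewrite /=; move: (jordan_pos p B) (jordan_neg p B) (m1 B) (m2 B).
  move=> [a| |] [b| |] [c| |] [e| |]//= [[[? ?] ?] ?]// [h].
  by congr EFin; lra.
lra.
Qed.

End change_of_variables.

Section pushforward_integral.
Context (R : realType) (d : nat).
Variables (g : 'rV[R]_d -> 'rV[R]_d).
Variables (mg : measurable_fun setT (g : Rd R d -> Rd R d)).

(** The pushforward of the Jordan decomposition of [nu] need not be the Jordan
decomposition of the pushforward of [nu], but it is a decomposition into finite
measures, which is enough. *)
Lemma charge_integral_pushforward (nu : {charge set (Rd R d) -> \bar R})
    (h : Rd R d -> R) (M : R) :
  measurable_fun setT h -> (forall x, `|h x| <= M) ->
  charge_integral (charge_pushforward mg nu) h = charge_integral nu (h \o g).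
Proof.
move=> mh hM.
rewrite {2}/charge_integral; set p := (X in jordan_pos X); clearbody p.
pose push (m : {measure set (Rd R d) -> \bar R}) :
    {measure set (Rd R d) -> \bar R} :=
  measure_function_pushforward__canonical__measure_function_Measure m mg.
have fp (m : {finite_measure set (Rd R d) -> \bar R}) : fin_num_fun (push m).
  move=> B mB; apply: fin_num_measure.
  by rewrite -[X in measurable X]setTI; exact: mg.
have pushE (m : {finite_measure set (Rd R d) -> \bar R}) :
    Rintegral (push m) setT h = Rintegral m setT (h \o g).
  have ihg : m.-integrable setT (EFin \o (h \o g)).
    apply: measurable_bounded_integrable => //.
    - by rewrite ltey_eq fin_num_measure.
    - exact: measurableT_comp.
    - exists M; split=> [|y My x _]; first exact: num_real.
      exact: le_trans (hM _) (ltW My).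
  congr fine; rewrite (integral_pushforward mg)//=; exact/measurable_EFinP.
rewrite (@charge_integral_difference _ _ _ _ (push (jordan_pos p))
  (push (jordan_neg p)) _ M)//.
- by rewrite !pushE.
- exact: fp.
- exact: fp.
move=> B mB; transitivity (nu (g @^-1` B)) => //.
rewrite (jordan_decomp p).
  by rewrite /cadd/= cscaleN1.
by rewrite -[X in measurable X]setTI; exact: mg.
Qed.

Lemma cintegral_pushforward (mu : cmeasure R d) (phi : Cc0 R d) :
  cintegral (cpushforward mg mu) phi = cintegral mu (phi \o g).
Proof.
have [pc _] := Cc0P phi.
have mRe := continuous_measurable_Rd (continuous_repart pc).
have mIm := continuous_measurable_Rd (continuous_impart pc).
have bRe x : `|repart phi x| <= supnorm phi.
  by apply: (le_trans (Re_le_cmod _)); apply: le_supnorm; exact: Cc0P.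
have bIm x : `|impart phi x| <= supnorm phi.
  by apply: (le_trans (Im_le_cmod _)); apply: le_supnorm; exact: Cc0P.
by rewrite /cintegral/= !(charge_integral_pushforward _ mRe bRe)
  !(charge_integral_pushforward _ mIm bIm).
Qed.

End pushforward_integral.

Lemma cintegral_bound (R : realType) (d : nat) (mu : cmeasure R d) :
  exists2 K : R, 0 <= K & forall (phi : Cc0 R d) M,
    (forall x, cmod (phi x) <= M) -> cmod (cintegral mu phi) <= K * M.
Proof.
have [K1 K10 h1] := charge_integral_bound (cm_re mu).
have [K2 K20 h2] := charge_integral_bound (cm_im mu).
exists (K1 + K2 + (K1 + K2)); first by rewrite !addr_ge0.
move=> phi M pM; have [pc _] := Cc0P phi.
have mRe := continuous_measurable_Rd (continuous_repart pc).
have mIm := continuous_measurable_Rd (continuous_impart pc).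
have bRe x : `|repart phi x| <= M by exact: (le_trans (Re_le_cmod _)).
have bIm x : `|impart phi x| <= M by exact: (le_trans (Im_le_cmod _)).
rewrite mulrDl (le_trans (cmod_le_ReIm _))//=.
rewrite mulrDl lerD//.
  by rewrite (le_trans (ler_normB _ _))// lerD// ?h1 ?h2.
by rewrite (le_trans (ler_normD _ _))// lerD// ?h1 ?h2.
Qed.

(** * Comparison of the supremum and Euclidean norms *)

Section norms.
Context (R : realType) (d : nat).
Implicit Types x : 'rV[R]_d.

Lemma coord_le_norm x i : `|x 0 i| <= `|x|.
Proof.
by rewrite [leRHS]/Num.norm /= mx_normrE; apply/bigmax_geP; right; exists (0, i).
Qed.

Lemma norm_le_coord x M : 0 <= M -> (forall i, `|x 0 i| <= M) -> `|x| <= M.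
Proof.
move=> M0 h; rewrite [leLHS]/Num.norm /= mx_normrE; apply/bigmax_leP; split => //.
by move=> [j i] _ /=; rewrite ord1.
Qed.

Lemma coord_le_enorm x i : `|x 0 i| <= enorm x.
Proof.
rewrite /enorm -sqrtr_sqr ler_wsqrtr// (bigD1 i)//= lerDl.
by apply: sumr_ge0 => *; exact: sqr_ge0.
Qed.

Lemma enorm_le_norm x : enorm x <= d%:R * `|x|.
Proof.
rewrite /enorm -[leRHS]ger0_norm ?mulr_ge0// -sqrtr_sqr ler_wsqrtr//.
apply: (@le_trans _ _ (\sum_(i < d) `|x| ^+ 2)).
  apply: ler_sum => i _; rewrite -real_normK ?num_real//.
  by rewrite ler_sqr ?nnegrE// coord_le_norm.
rewrite sumr_const card_ord -[leLHS]mulr_natl exprMn ler_wpM2r ?sqr_ge0//.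
by rewrite expr2 -natrM ler_nat; case: (d) => // n; rewrite leq_pmulr.
Qed.

End norms.

(** * A discrete Gronwall inequality *)

Section gronwall.
Context (R : realType).

(** On an interval so short that [c * (hi - lo) <= 1/2], the supremum [S] of the
norm of [y] satisfies [S <= `|y q| + (1 + S) / 2], hence [1 + S] is at most
[2 * (1 + `|y q|)]. *)
Lemma comparable_of_small_oscillation (V : normedModType R) (y : R -> V)
    (c lo hi : R) :
  c * (hi - lo) <= 2^-1 ->
  (exists B, forall s, lo <= s <= hi -> `|y s| <= B) ->
  (forall M, 0 <= M -> (forall s, lo <= s <= hi -> `|y s| <= M) ->
    forall p q, lo <= p <= hi -> lo <= q <= hi ->
    `|y p - y q| <= c * (1 + M) * (hi - lo)) ->
  forall p q, lo <= p <= hi -> lo <= q <= hi ->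
  1 + `|y p| <= 2 * (1 + `|y q|).
Proof.
move=> csmall [B yB] osc p q pI qI.
pose Y := [set `|y s| | s in [set s | lo <= s <= hi]].
have hY : has_sup Y.
  split; first by exists `|y p|, p.
  by exists B => _ [s sI <-]; exact: yB.
have yS s : lo <= s <= hi -> `|y s| <= sup Y.
  by move=> sI; apply: ub_le_sup; [exact: hY.2|exists s].
have S0 : 0 <= sup Y by apply: le_trans (yS p pI).
have Sq : sup Y <= `|y q| + (1 + sup Y) / 2.
  apply: ge_sup; first exact: hY.1.
  move=> _ [s sI <-].
  have := osc _ S0 yS s q sI qI.
  have := ler_normD (y s - y q) (y q); rewrite subrK.
  have : (1 + sup Y) * (c * (hi - lo)) <= (1 + sup Y) * 2^-1.
    by rewrite ler_wpM2l// addr_ge0.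
  lra.
have := yS p pI; lra.
Qed.

(** Chopping the way from [a] to [b] into [N] short intervals and chaining the
previous lemma gives [K = 2 ^+ N]. The estimate is symmetric in time, so it
bounds the initial point of a trajectory by its final point. *)
Lemma discrete_gronwall (c T : R) : 0 < c -> exists K : R,
  forall (V : normedModType R) (y : R -> V),
  (exists B, forall s, 0 <= s <= T -> `|y s| <= B) ->
  (forall lo hi M, 0 <= lo -> lo <= hi -> hi <= T -> 0 <= M ->
    (forall s, lo <= s <= hi -> `|y s| <= M) ->
    `|y hi - y lo| <= c * (1 + M) * (hi - lo)) ->
  forall a b, 0 <= a <= T -> 0 <= b <= T -> 1 + `|y a| <= K * (1 + `|y b|).
Proof.
move=> c0; pose h := (2 * c)^-1.
have h0 : 0 < h by rewrite invr_gt0 mulr_gt0.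
have ch : c * h = 2^-1 by rewrite /h; field; rewrite gt_eqF.
have [T0|T0] := ltP T 0.
  by exists 0 => V y _ _ a b /andP[a0 aT]; have := le_trans a0 aT; rewrite leNgt T0.
have [N TN] : exists N : nat, T <= N%:R * h.
  exists (Num.bound (T / h)); rewrite -ler_pdivrMr// ltW// archi_boundP//.
  by rewrite divr_ge0// ltW.
exists (2 ^+ N) => V y [B yB] yL.
have step a b : 0 <= a <= T -> 0 <= b <= T -> `|a - b| <= h ->
    1 + `|y a| <= 2 * (1 + `|y b|).
  move=> /andP[a0 aT] /andP[b0 bT] abh.
  pose lo := Num.min a b; pose hi := Num.max a b.
  have lo0 : 0 <= lo by rewrite le_min a0.
  have hiT : hi <= T by rewrite ge_max aT.
  have hilo : hi - lo = `|a - b|.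
    by rewrite /hi /lo; case: (leP a b) => ab; [rewrite distrC|];
      rewrite ger0_norm// subr_ge0 // ltW.
  apply: (@comparable_of_small_oscillation V y c lo hi).
  - by rewrite hilo -ch ler_wpM2l// ltW.
  - by exists B => s /andP[los shi]; rewrite yB// (le_trans lo0)// (le_trans shi).
  - move=> M M0 yM p q.
    wlog qp : p q / q <= p.
      move=> wl; case: (leP q p) => [|/ltW] qp pI qI; first exact: wl.
      by rewrite distrC; exact: wl.
    move=> /andP[lop phi] /andP[loq qhi].
    apply: (@le_trans _ _ (c * (1 + M) * (p - q))).
      apply: yL => //; [exact: le_trans loq|exact: le_trans hiT|].
      by move=> s /andP[qs sp]; rewrite yM// (le_trans loq)// (le_trans sp).
    by rewrite ler_wpM2l ?lerB// mulr_ge0 ?addr_ge0// ltW.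
  - by rewrite /lo /hi ge_min le_max !lexx.
  - by rewrite /lo /hi ge_min le_max !lexx !orbT.
have chain n a b : 0 <= a <= T -> 0 <= b <= T -> `|a - b| <= n%:R * h ->
    1 + `|y a| <= 2 ^+ n * (1 + `|y b|).
  elim: n a b => [|n IH] a b aI bI; rewrite ?mul0r.
    by rewrite normr_le0 subr_eq0 => /eqP ->; rewrite expr0 mul1r.
  (* [p] lies on the segment from [b] to [a], at one step from [a]. *)
  move=> ab; pose t : R := n%:R / n.+1%:R.
  have n1 : 0 < n.+1%:R :> R by rewrite ltr0n.
  have t0 : 0 <= t by rewrite divr_ge0.
  have t1 : t <= 1 by rewrite ler_pdivrMr// mul1r ler_nat.
  have tn : 1 - t = n.+1%:R^-1.
    by rewrite /t -natr1; field; rewrite natr1 gt_eqF.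
  pose p := b + t * (a - b).
  have pI : 0 <= p <= T.
    have -> : p = t * a + (1 - t) * b by rewrite /p; ring.
    move: aI bI => /andP[a0 aT] /andP[b0 bT].
    rewrite addr_ge0 ?mulr_ge0 ?subr_ge0//=.
    have : t * a <= t * T by rewrite ler_wpM2l.
    have : (1 - t) * b <= (1 - t) * T by rewrite ler_wpM2l ?subr_ge0.
    lra.
  have ap : `|a - p| <= h.
    have -> : a - p = (1 - t) * (a - b) by rewrite /p; ring.
    by rewrite normrM tn ger0_norm ?invr_ge0 ?ler_pdivrMl.
  have pb : `|p - b| <= n%:R * h.
    have -> : p - b = t * (a - b) by rewrite /p; ring.
    rewrite normrM ger0_norm// /t mulrAC ler_pdivrMr//.
    by rewrite -mulrA ler_wpM2l// mulrC.
  apply: le_trans (step _ _ aI pI ap) _.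
  by rewrite exprS -mulrA ler_wpM2l// IH.
move=> a b aI bI; apply: chain => //.
apply: le_trans TN; move: aI bI => /andP[a0 aT] /andP[b0 bT].
by rewrite ler_norml; apply/andP; split; lra.
Qed.

End gronwall.

(** * Oriented integrals for the completed Lebesgue measure *)

Section oriented_integral.
Context (R : realType).
Notation mu := (@completed_lebesgue_measure R).

Lemma completed_measurable_itv (i : interval R) :
  measurable ([set` i] : set (LebR R)).
Proof. by apply: sub_caratheodory; exact: measurable_itv. Qed.

(** The Lebesgue measure and its completion are the same outer measure, restricted
to two different sigma-algebras. *)
Lemma completed_itv_length (b0 b1 : bool) (a b : R) : a <= b ->
  mu [set` Interval (BSide b0 a) (BSide b1 b)] = (b - a)%:E.
Proof.
move=> ab.
transitivity (@lebesgue_measure R [set` Interval (BSide b0 a) (BSide b1 b)]).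
  by [].
rewrite lebesgue_measure_itv /= lte_fin.
have [//|ba] := ltP a b.
by congr EFin; apply/esym/eqP; rewrite subr_eq0 eq_le ab ba.
Qed.

Lemma le_norm_itv_integral (h : R -> R) (M a b : R) (b0 b1 : bool) : a <= b ->
  mu.-integrable [set` Interval (BSide b0 a) (BSide b1 b)] (EFin \o h) ->
  (forall s, a <= s <= b -> `|h s| <= M) ->
  `|Rintegral mu [set` Interval (BSide b0 a) (BSide b1 b)] h| <= M * (b - a).
Proof.
move=> ab ih hM; set I := [set` _] in ih *.
have mI : measurable (I : set (LebR R)) by exact: completed_measurable_itv.
apply: (le_trans (le_normr_Rintegral mI ih)).
have -> : M * (b - a) = Rintegral mu I (cst M).
  rewrite (Rintegral_cst mu mI); congr (M * _).
  by apply: esym; rewrite [X in fine X](completed_itv_length b0 b1 ab).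
apply: le_Rintegral => //.
- exact: integrable_norm ih.
- apply: measurable_bounded_integrable => //.
    by rewrite [X in (X < _)%E](completed_itv_length b0 b1 ab) ltry.
  by exists `|M|; split; [exact: num_real|move=> y My x _; exact: ltW].
- move=> s; rewrite /I /= in_itv/= => /andP[as_ sb]; apply: hM.
  by rewrite (lteifW as_) (lteifW sb).
Qed.

(** Stated for a base point [tau] in an arbitrary position with respect to [a] and
[b], because the flow is an integral from [tau] both forwards and backwards. *)
Lemma ointegral_increment (h : R -> R) (T M tau a b : R) :
  mu.-integrable `[0, T] (EFin \o h) ->
  0 <= tau <= T -> 0 <= a -> a <= b -> b <= T ->
  (forall s, a <= s <= b -> `|h s| <= M) ->
  `|ointegral tau b h - ointegral tau a h| <= M * (b - a).
Proof.
move=> ih /andP[tau0 tauT] a0 ab bT hM.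
have ihS (b0 b1 : bool) p q : 0 <= p -> q <= T ->
    mu.-integrable [set` Interval (BSide b0 p) (BSide b1 q)] (EFin \o h).
  move=> p0 qT; apply: integrableS ih; try exact: completed_measurable_itv.
  move=> s /=; rewrite !in_itv/= => /andP[/lteifW ps /lteifW sq].
  by rewrite (le_trans p0)// (le_trans sq).
have split (b0 b1 b2 : bool) p q r : 0 <= p -> r <= T ->
    (BSide b0 p <= BSide b1 q)%O -> (BSide b1 q <= BSide b2 r)%O ->
    Rintegral mu [set` Interval (BSide b0 p) (BSide b2 r)] h =
    Rintegral mu [set` Interval (BSide b0 p) (BSide b1 q)] h +
    Rintegral mu [set` Interval (BSide b1 q) (BSide b2 r)] h.
  move=> p0 rT pq qr; rewrite (itv_bndbnd_setU pq qr) Rintegral_setU//.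
  - exact: completed_measurable_itv.
  - exact: completed_measurable_itv.
  - by rewrite -(itv_bndbnd_setU pq qr); exact: ihS.
  - apply/disj_setPRL => s /=; rewrite !in_itv/= => /andP[qs _] /andP[_ sq].
    by move: qs sq; case: (b1) => /=; case: (ltgtP s q).
rewrite /ointegral.
(* The three positions of [tau]. Subtracting two closed intervals with a common
   endpoint removes that endpoint, hence the half-open intervals. *)
have [tb|bt] := leP tau b; last first.
  rewrite ifF; last by apply/negbTE; rewrite -ltNge (le_lt_trans ab).
  rewrite opprK addrC (split true true false a b tau)//; last first.
    by rewrite bnd_simp ltW.
  by rewrite addrK le_norm_itv_integral// ihS.
have [ta|at_] := leP tau a.
  rewrite (split true false false tau a b)//.
  by rewrite addrAC subrr add0r le_norm_itv_integral// ihS.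
rewrite opprK; apply: (le_trans (ler_normD _ _)).
have -> : M * (b - a) = M * (b - tau) + M * (tau - a) by ring.
rewrite lerD// le_norm_itv_integral// ?ihS ?(ltW at_)//.
- by move=> s /andP[ts sb]; rewrite hM// sb (le_trans (ltW at_)).
- by move=> s /andP[as_ st]; rewrite hM// as_ (le_trans st).
Qed.

Lemma le_norm_ointegral (h : R -> R) (T a b : R) :
  mu.-integrable `[0, T] (EFin \o h) -> 0 <= a <= T -> 0 <= b <= T ->
  `|ointegral a b h| <= Rintegral mu `[0, T] (fun s => `|h s|).
Proof.
move=> ih.
have sub p q : 0 <= p -> q <= T ->
    `|Rintegral mu `[p, q] h| <= Rintegral mu `[0, T] (fun s => `|h s|).
  move=> p0 qT.
  have pqT : `[p, q] `<=` `[0, T].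
    move=> s /=; rewrite !in_itv/= => /andP[ps sq].
    by rewrite (le_trans p0)// (le_trans sq).
  have m1 : measurable (`[p, q]%classic : set (LebR R)).
    exact: completed_measurable_itv.
  have m2 : measurable (`[0, T]%classic : set (LebR R)).
    exact: completed_measurable_itv.
  have ipq := integrableS m2 m1 pqT ih.
  apply: (le_trans (le_normr_Rintegral m1 ipq)).
  apply: fine_le.
  - by apply: integrable_fin_num => //; exact: integrable_norm ipq.
  - by apply: integrable_fin_num => //; exact: integrable_norm ih.
  - apply: (@ge0_subset_integral _ _ _ mu _ _ m1 m2) => //.
    exact: (measurable_int mu (integrable_norm ih)).
move=> /andP[a0 aT] /andP[b0 bT]; rewrite /ointegral; case: ifPn => _.
  exact: sub.
by rewrite normrN; exact: sub.
Qed.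

End oriented_integral.

(** * Properness of the flow *)

Section flow_estimate.
Context (R : realType) (d : nat) (U : metricType R).
Context (f : 'rV[R]_d -> U -> 'rV[R]_d) (T m : R).
Hypothesis m_gt0 : 0 < m.
Hypothesis f_sublinear : forall x u, enorm (f x u) <= m * (1 + enorm x).

Lemma sublinear_coord x u i : `|f x u 0 i| <= m * (1 + d%:R) * (1 + `|x|).
Proof.
apply: (le_trans (coord_le_enorm _ _)); apply: (le_trans (f_sublinear _ _)).
rewrite -mulrA ler_wpM2l ?(ltW m_gt0)// mulrDl mul1r -addrA lerD2l mulrDr mulr1.
by rewrite ler_wpDl// ler_wpDl// enorm_le_norm.
Qed.

(** Trajectories are bounded on [[0, T]] since [f] is integrable along them, and
by the integral equation their increments obey the hypothesis of the discrete
Gronwall inequality. Points that the flow sends to a bounded set therefore form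
a bounded set. *)
Lemma flow_comparable : exists K, forall u Phi, is_flow f T u Phi ->
  forall tau t x, 0 <= tau <= T -> 0 <= t <= T ->
  1 + `|x| <= K * (1 + `|Phi tau t x|).
Proof.
have c0 : 0 < m * (1 + d%:R) by rewrite mulr_gt0// ltr_wpDr.
have [K hK] := discrete_gronwall T c0; exists K => u Phi fl tau t x tauI tI.
have hx s i : 0 <= s <= T -> Phi tau s x 0 i =
    x 0 i + ointegral tau s (fun r => f (Phi tau r x) (u r) 0 i).
  by move=> sI; have [_ _ ->] := fl tau s tauI sI.
have hint i : (@completed_lebesgue_measure R).-integrable `[0, T]
    (EFin \o (fun s => f (Phi tau s x) (u s) 0 i)).
  by have [_ + _] := fl tau t tauI tI; exact.
have tau0 : 0 <= tau by case/andP: tauI.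
have tauT : tau <= T by case/andP: tauI.
have initial : Phi tau tau x = x.
  apply/rowP => i; rewrite hx// /ointegral lexx.
  set h := (fun r => f _ _ 0 i).
  suff -> : Rintegral (@completed_lebesgue_measure R) `[tau, tau] h = 0.
    by rewrite addr0.
  apply/eqP; rewrite -normr_le0.
  have -> : 0 = `|h tau| * (tau - tau) :> R by rewrite subrr mulr0.
  apply: le_norm_itv_integral => //.
    apply: integrableS (hint i); try exact: completed_measurable_itv.
    move=> s /=; rewrite !in_itv/= => /andP[? ?].
    by rewrite (le_trans tau0)// (le_trans _ tauT).
  by move=> s /le_anti <-.
rewrite -[in leLHS]initial.
apply: (hK _ (fun s => Phi tau s x)) => //.
- pose B i := Rintegral (@completed_lebesgue_measure R) `[0, T]
    (fun s => `|f (Phi tau s x) (u s) 0 i|).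
  have B0 i : 0 <= B i by apply: Rintegral_ge0.
  exists (\sum_i (`|x 0 i| + B i)) => s sI; apply: norm_le_coord.
    by apply: sumr_ge0 => i _; rewrite addr_ge0.
  move=> i; rewrite hx// (bigD1 i)//= ler_wpDr//.
    by apply: sumr_ge0 => j _; rewrite addr_ge0.
  apply: (le_trans (ler_normD _ _)); rewrite lerD2l.
  exact: (le_norm_ointegral (hint i) tauI sI).
- move=> lo hi M lo0 lohi hiT M0 yM; apply: norm_le_coord.
    by rewrite mulr_ge0 ?subr_ge0// mulr_ge0 ?addr_ge0// (ltW c0).
  move=> i; rewrite !mxE.
  rewrite !hx ?lo0 ?hiT ?(le_trans lo0 lohi) ?(le_trans lohi hiT)//.
  rewrite opprD addrACA subrr add0r.
  apply: (ointegral_increment (hint i) tauI lo0 lohi hiT).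
  move=> s sI; apply: (le_trans (sublinear_coord _ _ _)).
  by rewrite ler_wpM2l ?(ltW c0)// lerD2l yM.
Qed.

End flow_estimate.

Lemma continuous_measurable_Rd_Rd (R : realType) (d : nat)
    (g : 'rV[R]_d -> 'rV[R]_d) :
  continuous g -> measurable_fun setT (g : Rd R d -> Rd R d).
Proof.
move=> /continuousP cg.
apply: (@measurability _ _ (Rd R d) (Rd R d) setT g (@open 'rV[R]_d)) => //.
by move=> _ [B oB <-]; rewrite setTI; apply: sub_sigma_algebra; exact: cg.
Qed.

Section composition.
Context (R : realType) (d : nat).

Lemma csupport_bounded (phi : 'rV[R]_d -> cplx R) : compact (csupport phi) ->
  exists2 M : R, 0 <= M & forall x, csupport phi x -> `|x| <= M.
Proof.
move=> /compact_bounded [M [_ hM]]; exists (`|M| + 1); first by rewrite addr_ge0.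
by move=> x phix; apply: hM => //; rewrite (le_lt_trans (ler_norm M))// ltrDl.
Qed.

Lemma csupport_eq0 (phi : 'rV[R]_d -> cplx R) x : ~ csupport phi x -> phi x = 0.
Proof.
by move=> h; apply/eqP; apply: contra_notT h => h; exact: subset_closure.
Qed.

Lemma is_Cc0_comp_proper (phi : Cc0 R d) (g : 'rV[R]_d -> 'rV[R]_d) (K : R) :
  continuous g -> (forall x, 1 + `|x| <= K * (1 + `|g x|)) ->
  is_Cc0 (phi \o g).
Proof.
move=> gc gK; have [pc pK] := Cc0P phi; split.
  by move=> x; apply: continuous_comp; [exact: gc|exact: pc].
have [M M0 hM] := csupport_bounded pK.
pose B := [set x : 'rV[R]_d | `|x| <= `|K| * (1 + M)].
have cB : closed B.
  exact: (preimage_closed (fun x _ => @norm_continuous R 'rV[R]_d x)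
    (@closed_le _ (`|K| * (1 + M)))).
apply: (@compact_subclosure _ _ _ B) => //.
  apply: bounded_closed_compact => //.
  exists (`|K| * (1 + M)); split; first exact: num_real.
  by move=> y By x Bx; exact: le_trans Bx (ltW By).
move=> x /= px; have {}px : csupport phi (g x) by exact: subset_closure.
have := gK x; have := hM _ px => gM.
have : K * (1 + `|g x|) <= `|K| * (1 + M).
  apply: (@le_trans _ _ (`|K| * (1 + `|g x|))).
    by rewrite ler_wpM2r ?addr_ge0// ler_norm.
  by rewrite ler_wpM2l// lerD2l.
rewrite /B/=; lra.
Qed.

End composition.

(** * The adjoint of the Koopman operator *)

Section koopman_adjoint.
Context (R : realType) (d : nat) (T : R) (U : metricType R).
Context (f : 'rV[R]_d -> U -> 'rV[R]_d).
Hypothesis f_sublinear : exists2 m : R, 0 < m &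
  forall x u, enorm (f x u) <= m * (1 + enorm x).

(** By the change of variables formula, [mu] takes at [phi \o Phi] the value that
its pushforward by [Phi] takes at [phi]. Properness of the flow makes
[phi \o Phi] a compactly supported function, so both sides range over the same
controls. *)
Lemma koopman_adjoint (tau t : R) (mu : cmeasure R d) :
  0 <= tau <= T -> 0 <= t <= T ->
  adjoint (koopman f T tau t) (measure_dual mu) =
  wstar_clco (tdual_fun @` perron_frobenius f T tau t mu).
Proof.
move=> tauI tI; have [m m0 hm] := f_sublinear.
have [K hK] := @flow_comparable R d U f T m m0 hm.
have [C C0 hC] := cintegral_bound mu.
have comp_Cc0 u Phi (phi : Cc0 R d) : is_flow f T u Phi ->
    is_Cc0 (phi \o Phi tau t).
  move=> fl; apply: (@is_Cc0_comp_proper _ _ _ _ K).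
    by have [] := fl tau t tauI tI.
  by move=> x; exact: (hK u Phi fl tau t x tauI tI).
apply: adjoint_wstar_clco.
- by move=> _ [a _ <-]; exact: tdual_linear.
- move=> phi; exists (C * supnorm phi) => _ [_ [u [Phi [mPhi [_ fl ->]]]] <-].
  rewrite /= cintegral_pushforward.
  pose psi := MkCc0 (introT (Cc0_predP _) (comp_Cc0 u Phi phi fl)).
  apply: (hC psi) => x; apply: (le_supnorm (Phi tau t x)); exact: Cc0P.
- move=> phi; apply/seteqP; split => z.
    move=> [psi [u [Phi [cu fl psiE]]] <-].
    have mPhi : measurable_fun setT (Phi tau t : Rd R d -> Rd R d).
      by apply: continuous_measurable_Rd_Rd; have [] := fl tau t tauI tI.
    exists (measure_dual (cpushforward mPhi mu)).
      by eexists; [exists u, Phi, mPhi; split|].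
    by rewrite /= cintegral_pushforward; congr cintegral; apply/funext => x.
  move=> [_ [_ [u [Phi [mPhi [cu fl ->]]]] <-] <-].
  rewrite /= cintegral_pushforward.
  exists (MkCc0 (introT (Cc0_predP _) (comp_Cc0 u Phi phi fl))) => //.
  by exists u, Phi; split.
Qed.

End koopman_adjoint.

(** * The adjoint of the Liouville operator *)

Section liouville_adjoint.
Context (R : realType) (d : nat).

(** [graddot zeta g] as a vector of [Cc0], on which integration is linear and
bounded. *)
Definition graddotC (g : 'rV[R]_d -> 'rV[R]_d) (gc : continuous g)
    (zeta : Cc1 R d) : Cc0 R d :=
  MkCc0 (introT (Cc0_predP _) (graddot_Cc0 zeta gc)).

Lemma graddotC_linear g (gc : continuous g) : linear (graddotC gc).
Proof.
move=> a phi psi; apply/val_inj/funext => x /=.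
have [pr pm _ _] := Cc1P phi; have [qr qm _ _] := Cc1P psi.
transitivity (a *: graddot phi g x + graddot psi g x); last by [].
rewrite /graddot scaler_sumr -big_split/=; apply: eq_bigr => i _.
rewrite -[cpartial i (a *: phi + psi) x]/
  (cpartial i (fun y => a *: phi y + psi y) x).
by rewrite cpartial_lincomb// mulrDl scalerAl.
Qed.

Lemma graddot_lincomb (zeta : 'rV[R]_d -> cplx R) (g h : 'rV[R]_d -> 'rV[R]_d)
    (s t : R) x :
  graddot zeta (fun y => s *: g y + t *: h y) x =
  s%:C%C *: graddot zeta g x + t%:C%C *: graddot zeta h x.
Proof.
rewrite /graddot !scaler_sumr -big_split/=; apply: eq_bigr => i _.
rewrite !mxE rmorphD !rmorphM /=.
by rewrite mulrDr; congr (_ + _); rewrite mulrCA.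
Qed.

Lemma graddot_csupport (zeta : 'rV[R]_d -> cplx R) g x :
  ~ csupport zeta x -> graddot zeta g x = 0.
Proof.
move=> xz; rewrite /graddot big1// => i _.
rewrite (csupport_eq0 (phi := cpartial i zeta)) ?mul0r// => /csupport_cpartial.
exact: xz.
Qed.

Lemma continuous_real_complex : continuous (fun r : R => r%:C%C : cplx R).
Proof.
move=> x; apply/(@cvgrPdist_lt _ (cplx R) _ _ (nbhs_filter x)) => e e0.
have eR : e = (complex.Re e)%:C%C by rewrite RRe_real// gtr0_real.
have e1 : 0 < complex.Re e by rewrite -ltcR -eR.
have := @nbhsx_ballx _ _ x _ e1; apply: filterS => y.
rewrite /ball/= eR -rmorphB -ltcR normc_def/= expr0n addr0.
by rewrite sqrtr_sqr.
Qed.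

Lemma cintegral_lincomb (mu : cmeasure R d) (a b : complex R)
    (phi psi : Cc0 R d) :
  cintegral mu (a *: phi + b *: psi) =
  a *: cintegral mu phi + b *: cintegral mu psi.
Proof.
pose L : {linear Cc0 R d -> cplx R} := HB.pack
  (fun phi : Cc0 R d => cintegral mu phi)
  (GRing.isLinear.Build _ _ _ _ _ (@cintegral_linear R d mu)).
by rewrite -[LHS]/(L (a *: phi + b *: psi)) linearP linearZ.
Qed.

Lemma cintegralB (mu : cmeasure R d) (phi psi : Cc0 R d) :
  cintegral mu (phi - psi) = cintegral mu phi - cintegral mu psi.
Proof.
by have := cintegral_lincomb mu 1 (-1) phi psi; rewrite !scaleN1r !scale1r.
Qed.

Context (U : metricType R) (f : 'rV[R]_d -> U -> 'rV[R]_d).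
Hypothesis U_compact : compact [set: U].
Hypothesis f_continuous : continuous (fun p : 'rV[R]_d * U => f p.1 p.2).
Hypothesis f_sublinear : exists2 m : R, 0 < m &
  forall x u, enorm (f x u) <= m * (1 + enorm x).

Lemma continuous_field u : continuous (f ^~ u).
Proof.
move=> x A /(@f_continuous (x, u)) [[P Q] /= [xP uQ] PQA].
apply: filterS xP => y Py; apply: (PQA (y, u)); split => //.
exact: nbhs_singleton.
Qed.

Arguments continuous_field : clear implicits.

Let gdot u zeta := graddotC (continuous_field u) zeta.

Lemma neg_divergenceE mu u :
  - divergence mu (f ^~ u) =
  fun zeta : Cc1 R d => cintegral mu (gdot u zeta).
Proof. by apply/funext => zeta; rewrite /divergence opprfctE opprK. Qed.

Lemma neg_divergence_linear mu u :
  linear (fun zeta : Cc1 R d => cintegral mu (gdot u zeta)).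
Proof.
move=> a x y.
by rewrite [gdot u _](graddotC_linear (continuous_field u)) cintegral_linear.
Qed.

(** Although a single [- div (f_u mu)] may be unbounded for the C^1 norm, its values
at a fixed [zeta] are bounded uniformly in [u]: only the restriction of [f] to the
support of [zeta] enters, and there the sublinear growth bounds [f]. *)
Lemma neg_divergence_bounded mu (zeta : Cc1 R d) : exists M, forall u,
  cmod (cintegral mu (gdot u zeta)) <= M.
Proof.
have [C C0 hC] := cintegral_bound mu.
have [m m0 hm] := f_sublinear.
have [_ _ _ zK] := Cc1P zeta.
have [B B0 hB] := csupport_bounded zK.
pose D := m * (1 + d%:R) * (1 + B).
have D0 : 0 <= D by rewrite !mulr_ge0 ?addr_ge0// ltW.
pose S i := supnorm (cpartial i zeta).
have S0 i : 0 <= S i by apply/supnorm_ge0/cpartial_Cc0; exact: Cc1P.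
exists (C * \sum_i (S i * D)) => u; apply: hC => x /=.
have [zx|/graddot_csupport ->] := pselect (csupport zeta x); last first.
  by rewrite cmod_real// sumr_ge0// => i _; rewrite mulr_ge0.
rewrite /graddot; elim/big_ind2 : _.
- by rewrite cmod_real.
- by move=> p q p' q' pp qq; rewrite (le_trans (cmodD _ _))// lerD.
- move=> i _; rewrite (_ : cmod _ =
    cmod (cpartial i zeta x) * cmod ((f x u 0 i)%:C%C));
      last exact: cmod_mul.
    rewrite ler_pM ?cmod_ge0//.
    by apply: le_supnorm; apply: cpartial_Cc0; exact: Cc1P.
  apply: (le_trans (cmod_le_ReIm _)); rewrite /= normr0 addr0.
  apply: (le_trans (sublinear_coord m0 hm _ _ _)).
  by rewrite ler_wpM2l ?lerD2l ?hB// mulr_ge0 ?addr_ge0// ltW.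
Qed.

Lemma liouville_adjoint mu :
  adjoint (liouville f) (measure_dual mu) = wstar_clco (neg_divergences f mu).
Proof.
apply: adjoint_wstar_clco.
- by move=> _ [u _ <-]; rewrite neg_divergenceE; exact: neg_divergence_linear.
- move=> zeta; have [M hM] := neg_divergence_bounded mu zeta.
  by exists M => _ [u _ <-]; rewrite neg_divergenceE.
- move=> zeta; apply/seteqP; split => z.
    move=> [psi [u psiE] <-]; exists (- divergence mu (f ^~ u)); first by exists u.
    rewrite neg_divergenceE /=; congr cintegral.
    by apply/funext => x; rewrite psiE.
  move=> [_ [u _ <-] <-]; rewrite neg_divergenceE; exists (gdot u zeta) => //.
  by exists u.
Qed.

Lemma convex_neg_divergences mu :
  convex_set [set f ^~ u | u in [set: U]] -> convex_set (neg_divergences f mu).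
Proof.
move=> cf; apply: convex_set_of_real_weight => _ _ t [u _ <-] [v _ <-] /andP[t0 t1].
have /set_mem[w _ wE] := cf (f ^~ u) (f ^~ v) (Itv01 t0 t1)
  (mem_set (ex_intro2 _ _ u I erefl)) (mem_set (ex_intro2 _ _ v I erefl)).
exists w => //; rewrite !neg_divergenceE; apply/funext => zeta.
have -> : gdot w zeta = t%:C%C *: gdot u zeta + (1 - t)%:C%C *: gdot v zeta.
  apply/val_inj/funext => x /=; rewrite wE.
  exact: (graddot_lincomb zeta (f ^~ u) (f ^~ v) t (1 - t) x).
exact: cintegral_lincomb.
Qed.

(** For a fixed [zeta], the functions [graddot zeta (f ^~ v)] converge uniformly to
[graddot zeta (f ^~ u)] as [v] tends to [u]: their difference is jointly
continuous and vanishes at [v = u], and the support of [zeta] is compact. *)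
Lemma neg_divergence_continuous mu :
  continuous (fun u => (- divergence mu (f ^~ u) : {ptws Cc1 R d -> cplx R})).
Proof.
move=> u; apply/pointwise_cvgP => zeta.
apply/(@cvgrPdist_lt _ (cplx R)) => e e0.
have eR : e = (complex.Re e)%:C%C by rewrite RRe_real// gtr0_real.
have e1 : 0 < complex.Re e by rewrite -ltcR -eR.
have [C C0 hC] := cintegral_bound mu.
have [_ _ zc zK] := Cc1P zeta.
pose e' := complex.Re e / (C + 1).
have e'0 : 0 < e' by rewrite divr_gt0// ltr_wpDl.
pose H (p : 'rV[R]_d * U) : cplx R :=
  graddot zeta (f ^~ u) p.1 - graddot zeta (f ^~ p.2) p.1.
have fstc : continuous (@fst 'rV[R]_d U) by move=> p; exact: cvg_fst.
have Hc : continuous H.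
  move=> p; apply: cvgB.
    apply: (@continuous_comp _ _ _ (@fst 'rV[R]_d U) (graddot zeta (f ^~ u))).
      exact: fstc.
    exact: (graddot_Cc0 zeta (continuous_field u)).1.
  apply: (@continuous_sum_mul (complex R) _ _ _
    (fun i p => cpartial i zeta p.1) (fun i p => (f p.1 p.2 0 i)%:C%C)) => i q.
    apply: (@continuous_comp _ _ _ (@fst 'rV[R]_d U) (cpartial i zeta)).
      exact: fstc.
    exact: zc.
  apply: (@continuous_comp _ _ _ (fun q : 'rV[R]_d * U => f q.1 q.2 0 i)
    (fun r : R => r%:C%C : cplx R)); last exact: continuous_real_complex.
  apply: (@continuous_comp _ _ _ (fun q : 'rV[R]_d * U => f q.1 q.2)
    (fun y : 'rV[R]_d => y 0 i)); first exact: f_continuous.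
  exact: coord_continuous.
have near_u : \forall v \near u,
    csupport zeta `<=` [set x | cmod (H (x, v)) < e'].
  apply: ((compact_near_coveringP _).1 zK _ (nbhs u)
    (fun v x => cmod (H (x, v)) < e')) => x _.
  have cHc : {for (x, u), continuous (fun p => cmod (H p))}.
    by apply: continuous_comp; [exact: Hc|exact: continuous_cmod].
  apply: (@cvgr_lt _ _ _ _ _ _ cHc e').
  by rewrite /H/= subrr cmod_real.
apply: filterS near_u => v hv /=.
rewrite eR !neg_divergenceE -cmodE ltcR -cintegralB.
apply: (@le_lt_trans _ _ (C * e')).
  apply: hC => x; have [zx|zx] := pselect (csupport zeta x).
    exact: ltW (hv x zx).
  have -> : (gdot u zeta - gdot v zeta) x =
    graddot zeta (f ^~ u) x - graddot zeta (f ^~ v) x by [].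
  by rewrite !graddot_csupport// subrr cmod_real// ltW.
by rewrite /e' mulrA ltr_pdivrMr ?ltr_wpDl// mulrC ltr_pM2l// ltrDl.
Qed.

Lemma closed_neg_divergences mu :
  closed (neg_divergences f mu : set {ptws Cc1 R d -> cplx R}).
Proof.
apply: compact_closed.
  exact: (@hausdorff_product _ (fun=> cplx R) (fun=> @norm_hausdorff _ _)).
apply: continuous_compact => //; apply: continuous_subspaceT.
exact: neg_divergence_continuous.
Qed.

(** The set of the [- div (f_u mu)] is then convex, and it is closed as the
continuous image of the compact space [U], hence it is its own closed convex
hull. *)
Lemma liouville_adjoint_convex mu : convex_set [set f ^~ u | u in [set: U]] ->
  adjoint (liouville f) (measure_dual mu) =
  [set nu : tdual (Cc1 R d) | neg_divergences f mu nu].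
Proof.
move=> cf; rewrite liouville_adjoint /wstar_clco.
have -> : convex_hull (neg_divergences f mu) = neg_divergences f mu.
  apply/seteqP; split; last exact: sub_convex_hull.
  by apply: convex_hull_min => //; exact: convex_neg_divergences.
by rewrite -(closure_id _).1//; exact: closed_neg_divergences.
Qed.

End liouville_adjoint.

(** * The adjoint formulas *)

Theorem theorem4p10 (R : realType) (d : nat) (T : R) (U : metricType R)
    (f : 'rV[R]_d -> U -> 'rV[R]_d)
    (T_gt0 : 0 < T)
    (U_compact : compact [set: U])
    (f_continuous : continuous (fun p : 'rV[R]_d * U => f p.1 p.2))
    (f_sublinear : exists2 m : R, 0 < m &
      forall x u, enorm (f x u) <= m * (1 + enorm x))
    (f_lipschitz : forall K : set 'rV[R]_d, compact K ->
      exists2 l : R, 0 < l &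
        forall x y u, K x -> K y ->
          enorm (f x u - f y u) <= l * enorm (x - y)) :
  [/\ forall mu : cmeasure R d,
        adjoint (liouville f) (measure_dual mu) =
        wstar_clco (neg_divergences f mu),
      forall (tau t : R) (mu : cmeasure R d),
        0 <= tau <= T -> 0 <= t <= T ->
        adjoint (koopman f T tau t) (measure_dual mu) =
        wstar_clco (tdual_fun @` perron_frobenius f T tau t mu) &
      convex_set [set f ^~ u | u in [set: U]] ->
      forall mu : cmeasure R d,
        adjoint (liouville f) (measure_dual mu) =
        [set nu : tdual (Cc1 R d) | neg_divergences f mu nu] ].
Proof.
split=> [mu|tau t mu tauI tI|fconvex mu].
- exact: liouville_adjoint.
- exact: koopman_adjoint.
- exact: liouville_adjoint_convex.
Qed.
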